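(* Let $\alpha>0$ and let $x$ be a fixed positive integer. Let $\ell(x)$ be the local time at $x$ of the one-dimensional random interlacements at level $\alpha$. For $n>x$ let $t_n=\left\lfloor \frac{4\alpha n^3}{\pi^2}\right\rfloor$ and let $L_n(x)$ be the local time at $x$, i.e. the number of $s\in\{0,1,\dots,t_n\}$ with $X_s=x$, of the simple random walk $(X_s)$ on the ring graph $R_{2n}$ started at the site $n$ and conditioned on not hitting the origin $0$ up to time $t_n$. Then $L_n(x)$ converges in law to $\ell(x)$ as $n\to\infty$.
   Context: The ring graph $R_{2n}$ has vertex set $\{0,1,\dots,2n-1\}$ with edges between $i$ and $i+1$ modulo $2n$. The simple random walk jumps to each of the two neighbours with probability $1/2$; conditioning on not hitting the origin up to time $t$ means conditioning on $\{X_s\neq 0\text{ for all }0\le s\le t\}$. One-dimensional random interlacements at level $\alpha$ is a Poisson process of doubly infinite trajectories of the simple random walk conditioned on never hitting $0$ (on the positive integers this walk has transition probabilities $P(y,y+1)=\frac{y+1}{2y}$, $P(y,y-1)=\frac{y-1}{2y}$, $y\ge1$). The local time $\ell(x)$ at a site $x$ is the total number of visits to $x$ by all trajectories at level $\alpha$. For a positive integer $x$, the number $N_{\{x\}}$ of trajectories hitting $x$ is Poisson with parameter $\alpha x/2$, and each such trajectory visits $x$ a geometric number of times with success probability $\frac1{2x}$; thus $$\ell(x)=\sum_{k=1}^{N_{\{x\}}}V_k,$$ where $N_{\{x\}}\sim\mathrm{Poisson}(\alpha x/2)$ and $V_1,V_2,\dots$ are i.i.d., independent of $N_{\{x\}}$,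 with $\mathbb{P}[V_k=j]=\frac{1}{2x}\left(1-\frac{1}{2x}\right)^{j-1}$ for $j\ge 1$. *)

(* Defs.v *)
From HB Require Import structures.
From mathcomp Require Import all_boot all_order all_algebra.
From mathcomp Require Import all_classical all_reals all_analysis.

Set Implicit Arguments.
Unset Strict Implicit.
Unset Printing Implicit Defensive.

Import Order.TTheory GRing.Theory Num.Theory.
Import numFieldNormedType.Exports.

Local Open Scope classical_set_scope.
Local Open Scope ring_scope.

Definition mutually_independent (R : realType) (d d' : measure_display)
    (T : measurableType d) (T' : measurableType d') (P : probability T R)
    (I : eqType) (X : I -> {mfun T >-> T'}) : Prop :=
  forall (J : seq I) (A : I -> set T'),
    uniq J -> (forall i, measurable (A i)) ->
    P (\big[setI/setT]_(i <- J) (X i @^-1` A i)) =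
    (\prod_(i <- J) fine (P (X i @^-1` A i)))%:E.

(* The laws of X n under P n converge weakly to the law of Y under Q; the
   X n may live on different probability spaces. *)
Definition cvg_in_law (R : realType)
    (d : nat -> measure_display) (T : forall n, measurableType (d n))
    (P : forall n, probability (T n) R) (X : forall n, {mfun T n >-> R})
    (d' : measure_display) (T' : measurableType d')
    (Q : probability T' R) (Y : {mfun T' >-> R}) : Prop :=
  forall f : R -> R, continuous f -> (exists M : R, forall r, `|f r| <= M) ->
    (\int[distribution (P n) (X n)]_r (f r)%:E)%E @[n --> \oo]
      --> (\int[distribution Q Y]_r (f r)%:E)%E.

(* The conditional probability P( . | E). The second argument of mnormalize is
   the value taken by convention when P E = 0. *)
Definition cond_prob (R : realType) (d : measure_display)
    (T : measurableType d) (P : probability T R) (E : set T)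
    (mE : measurable E) : probability T R :=
  mnormalize (mrestr P mE) P.

Definition ring_adj (n i j : nat) : bool :=
  [&& (i < n.*2)%N, (j < n.*2)%N &
      (j == i.+1 %[mod n.*2]) || (i == j.+1 %[mod n.*2])].

(* Intended for n >= 2, when every vertex of R_{2n} has two distinct
   neighbours. *)
Definition ring_step (R : realType) (n i j : nat) : R :=
  if ring_adj n i j then 2^-1 else 0.

Definition is_ring_walk (R : realType) (d : measure_display)
    (T : measurableType d) (P : probability T R) (n start : nat)
    (X : nat -> {mfun T >-> nat}) : Prop :=
  forall (t : nat) (u : nat -> nat),
    P [set w | forall s, (s <= t)%N -> X s w = u s] =
    ((u 0%N == start)%:R * \prod_(s < t) ring_step R n (u s) (u s.+1))%:E.

Definition avoids_origin (d : measure_display) (T : measurableType d)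
    (X : nat -> {mfun T >-> nat}) (t : nat) : set T :=
  [set w | forall s, (s <= t)%N -> X s w <> 0%N].

Lemma measurable_avoids_origin (d : measure_display) (T : measurableType d)
    (X : nat -> {mfun T >-> nat}) (t : nat) : measurable (avoids_origin X t).
Proof.
rewrite (_ : avoids_origin X t =
  \bigcap_(s in [set s | (s <= t)%N]) (X s @^-1` [set k | k <> 0%N])) //.
apply: bigcap_measurableType => s _.
by rewrite -[X in measurable X]setTI; exact: measurable_funP.
Qed.

Definition local_time (R : realType) (d : measure_display)
    (T : measurableType d) (X : nat -> {mfun T >-> nat}) (t x : nat)
    (w : T) : R :=
  (\sum_(s < t.+1) (X s w == x))%N%:R.

Lemma measurable_local_time (R : realType) (d : measure_display)
    (T : measurableType d) (X : nat -> {mfun T >-> nat}) (t x : nat) :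
  measurable_fun setT (local_time R X t x).
Proof.
rewrite (_ : local_time R X t x =
  fun w => \sum_(s < t.+1) (fun k : nat => (k == x)%:R : R) (X s w)).
  apply: measurable_sum => s.
  by apply: (measurableT_comp (f := fun k : nat => (k == x)%:R : R)).
by apply/funext => w; rewrite /local_time natr_sum.
Qed.

HB.instance Definition _ (R : realType) (d : measure_display)
    (T : measurableType d) (X : nat -> {mfun T >-> nat}) (t x : nat) :=
  @isMeasurableFun.Build _ _ _ _ (local_time R X t x)
    (@measurable_local_time R d T X t x).

(* One-dimensional random interlacements at level alpha enter through their
   trace on the site x: N is the number of trajectories that hit x, and V k is
   the number of visits to x of the (k+1)-st of them. *)
Definition interlacement_visits (R : realType) (alpha : R) (x : nat)
    (d : measure_display) (T : measurableType d) (P : probability T R)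
    (N : {mfun T >-> nat}) (V : nat -> {mfun T >-> nat}) : Prop :=
  [/\ forall k, P (N @^-1` [set k]) = (poisson_pmf (alpha * x%:R / 2) k)%:E,
      forall k j, (1 <= j)%N -> P (V k @^-1` [set j]) =
        ((2 * x%:R)^-1 * (1 - (2 * x%:R)^-1) ^+ j.-1)%:E
    & mutually_independent P
        (oapp V N : option nat -> {mfun T >-> nat})].

Definition interlacement_local_time (R : realType) (d : measure_display)
    (T : measurableType d) (N : {mfun T >-> nat}) (V : nat -> {mfun T >-> nat})
    (w : T) : R :=
  (\sum_(k < N w) V k w)%N%:R.

Lemma measurable_interlacement_local_time (R : realType)
    (d : measure_display) (T : measurableType d) (N : {mfun T >-> nat})
    (V : nat -> {mfun T >-> nat}) :
  measurable_fun setT (interlacement_local_time R N V).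
Proof.
move=> _ A mA; rewrite setTI.
pose S m w : R := \sum_(k < m) (fun j : nat => j%:R : R) (V k w).
have mS m : measurable_fun setT (S m).
  apply: measurable_sum => k.
  by apply: (measurableT_comp (f := fun j : nat => j%:R : R)).
rewrite (_ : _ @^-1` A =
    \bigcup_m ((N @^-1` [set m]) `&` (S m @^-1` A))); last first.
  apply/seteqP; split => [w /= Aw|w [m _ [/= Nm]]].
    by exists (N w) => //; split=> //=; rewrite /S -natr_sum.
  by rewrite /S -natr_sum -Nm.
apply: bigcup_measurable => m _; apply: measurableI.
  by rewrite -[X in measurable X]setTI; exact: measurable_funP.
by rewrite -[X in measurable X]setTI; exact: mS.
Qed.

HB.instance Definition _ (R : realType) (d : measure_display)
    (T : measurableType d) (N : {mfun T >-> nat})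
    (V : nat -> {mfun T >-> nat}) :=
  @isMeasurableFun.Build _ _ _ _ (interlacement_local_time R N V)
    (@measurable_interlacement_local_time R d T N V).

(* The argument is nonnegative, so truncn is the floor. *)
Definition ring_time (R : realType) (alpha : R) (n : nat) : nat :=
  Num.truncn (4 * alpha * n%:R ^+ 3 / pi ^+ 2).

(* Main.v *)
Require Import Defs.
From HB Require Import structures.
From mathcomp Require Import all_boot all_order all_algebra.
From mathcomp Require Import all_classical all_reals all_analysis.
From mathcomp Require Import measurable_realfun zify ring lra.

Set Implicit Arguments.
Unset Strict Implicit.
Unset Printing Implicit Defensive.

Import Order.TTheory GRing.Theory Num.Theory.
Import numFieldNormedType.Exports.

Local Open Scope classical_set_scope.
Local Open Scope ring_scope.

(* The walk killed at 0 and weighted by z at each visit to x has an explicit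
   positive eigenfunction: a sine vanishing at 0 glued at x to a sine vanishing
   at 2n. Prescribing the angle pi / (2n - kappa) of the second sine, instead of
   z, makes everything explicit: z is then read off the kink at x, and it tends
   to a Moebius function of kappa. Since t_n ~ 4 alpha n^3 / pi^2, the ratio of
   the weighted and unweighted top eigenvalues to the power t_n tends to
   exp (- alpha kappa / 2). This gives the generating function of the local time
   weighted at the final time by the principal sine.
   To replace that final weight by 1 (survival), one drops the weights z on a
   last stretch of length ~ n^(5/2): it is longer than the mixing time n^2, so
   that survival over it is proportional to the principal sine (by the spectral
   decomposition of the killed walk), and shorter than n^3, so that visits to x
   during it are negligible.
   Finally exp (- alpha kappa / 2), as a function of the limit of z, is the
   generating function of the compound Poisson law of the interlacements, and
   convergence of generating functions near 0 gives that of the point masses. *)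

(** * Spectral decomposition of the killed walk *)

(** Two obstacles shape the estimates. First, the ring is bipartite: with a = pi / 2n, the killed
    walk also has the eigenvalue - cos a, of the same modulus as the principal one, and no spectral
    gap removes its mode. That mode is negligible only because the indicator of the interior has a
    coefficient O(1/n) on it. Second, the constant 1 is not dominated by the principal sine s near 0
    and 2n, so the survival lost to the weights of the last stretch is not bounded by the
    sine-weighted loss. The latter tends to 0, since the sine-weighted generating function has the
    same limit at both ends of the stretch. The inequality 1 <= K s / 2 + 1 / (2 K s) transfers this
    to survival: the coefficient of 1 / s on the principal sine is at most 2, so the second term is
    O(1/K), and K is chosen large. The exponent alpha kappa / 2 comes from cos a - cos th ~ (th^2 -
    a^2) / 2 ~ pi^2 kappa / (8 n^3), where th = pi / (2n - kappa). *)

Definition inner (n y : nat) : bool := (0 < y < n.*2)%N.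

(** The value 0 outside the interior encodes the killing; the origin appears twice, as 0 and as
    2n. *)
Definition avg (R : realType) (n : nat) (f : nat -> R) (y : nat) : R :=
  if inner n y then (f y.-1 + f y.+1) / 2 else 0.

(** The weight is charged on arrival, so the starting site is not counted. *)
Definition wavg (R : realType) (n : nat) (w f : nat -> R) : nat -> R :=
  avg n (fun y => w y * f y).

Definition angle (R : realType) (n : nat) : R := pi / n.*2%:R.

Definition sine_coef (R : realType) (n : nat) (g : nat -> R) (k : nat) : R :=
  n%:R^-1 * \sum_(y < n.*2) g y * sin (k%:R * angle R n * y%:R).

Section Spectral.
Variables (R : realType).
Implicit Types (n j k y t : nat) (g : nat -> R).

Lemma cos_natmul_pi j : cos (j%:R * pi) = (-1) ^+ j :> R.
Proof.
elim: j => [|j IH]; first by rewrite mul0r cos0 expr0.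
by rewrite -addn1 natrD mulrDl mul1r cosDpi IH exprD expr1 mulrN1.
Qed.

Lemma sin_natmul_pi j : sin (j%:R * pi) = 0 :> R.
Proof.
elim: j => [|j IH]; first by rewrite mul0r sin0.
by rewrite -addn1 natrD mulrDl mul1r sinDpi IH oppr0.
Qed.

Lemma angle_gt0 n : (0 < n)%N -> 0 < angle R n.
Proof. by move=> n0; rewrite divr_gt0 ?pi_gt0// ltr0n double_gt0. Qed.

Lemma angle_pi n : (0 < n)%N -> n.*2%:R * angle R n = pi.
Proof.
by move=> n0; rewrite /angle mulrC divfK// pnatr_eq0 double_eq0 -lt0n.
Qed.

Lemma angle_pihalf n : (0 < n)%N -> angle R n * n%:R = pi / 2.
Proof.
move=> n0; have := angle_pi n0; rewrite -mul2n natrM => <-.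
by field.
Qed.

(** Multiplying by [sin (b / 2)] makes the sum telescope; the bounds on [j] put [b / 2] strictly
    between 0 and pi, so that this factor can be cancelled. *)
Lemma sum_cos n j : (0 < j < n.*2.*2)%N ->
  \sum_(k < n.*2) cos (k%:R * angle R n * j%:R) = (1 - (-1) ^+ j) / 2 :> R.
Proof.
move=> /andP[j0 jn]; have n0 : (0 < n)%N by case: n jn.
set b := angle R n * j%:R.
have b0 : 0 < b by rewrite mulr_gt0 ?angle_gt0 ?ltr0n.
have sb : 0 < sin (b / 2).
  apply: sin_gt0_pi; rewrite divr_gt0//=.
  rewrite ltr_pdivrMr//.
  have -> : pi * 2 = angle R n * n.*2.*2%:R :> R.
    by rewrite -(angle_pi n0) -[n.*2.*2]mul2n natrM; ring.
  by rewrite ltr_pM2l ?angle_gt0// ltr_nat.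
apply: (mulfI (lt0r_neq0 sb)).
have tel N : sin (b / 2) * \sum_(k < N) cos (k%:R * angle R n * j%:R) =
    (sin (N%:R * b - b / 2) + sin (b / 2)) / 2.
  elim: N => [|N IH].
    by rewrite big_ord0 mulr0 mul0r sub0r sinN addNr mul0r.
  rewrite big_ord_recr/= mulrDr IH -[_ * j%:R]mulrA -/b.
  have -> : N.+1%:R * b - b / 2 = N%:R * b + b / 2 by rewrite -natr1; field.
  by rewrite sinB sinD; field.
rewrite tel.
have -> : n.*2%:R * b = j%:R * pi by rewrite /b mulrA angle_pi// mulrC.
by rewrite sinB sin_natmul_pi cos_natmul_pi; field.
Qed.

(** Orthogonality, summed over the frequencies. The product of sines becomes a difference of cosines
    at [y - z] and [y + z]; these have the same parity, so for distinct sites the two sums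
    cancel. *)
Lemma sum_sin_sin n y z : inner n y -> inner n z ->
  \sum_(k < n.*2) sin (k%:R * angle R n * y%:R) * sin (k%:R * angle R n * z%:R)
  = (y == z)%:R * n%:R :> R.
Proof.
wlog yz : y z / (z <= y)%N => [H iy iz|/andP[y0 yn] /andP[z0 zn]].
  case/orP: (leq_total y z) => [yz|zy]; last exact: H.
  by rewrite eq_sym -H//; apply: eq_bigr => k _; rewrite mulrC.
under eq_bigr => k _.
  rewrite (_ : _ * _ = (cos (k%:R * angle R n * (y - z)%:R) -
    cos (k%:R * angle R n * (y + z)%:R)) / 2); last first.
    by rewrite natrB// natrD mulrBr mulrDr cosB cosD; field.
  over.
rewrite -mulr_suml sumrB [X in _ - X]sum_cos; last first.
  by lia.
case: eqVneq => [<-|yz'].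
  under eq_bigr do rewrite subnn mulr0 cos0.
  rewrite sumr_const card_ord -[X in _ - (1 - X)/2]signr_odd addnn odd_double.
  by rewrite expr0 mul1r -mul2n natrM; field.
rewrite sum_cos; last by lia.
by rewrite -signr_odd oddB// -oddD signr_odd subrr !mul0r.
Qed.

Lemma sin_angle_end n k : (0 < n)%N -> sin (k%:R * angle R n * n.*2%:R) = 0 :> R.
Proof. by move=> n0; rewrite -mulrA [angle _ _ * _]mulrC angle_pi// sin_natmul_pi. Qed.

(* Diagonalization of the walk killed at 0 by the sines [sin (k a y)],
   [a = pi / 2n]. *)
Lemma iter_avgE n g t y : (0 < n)%N -> g 0%N = 0 -> g n.*2 = 0 ->
  (y <= n.*2)%N ->
  iter t (avg n) g y = \sum_(k < n.*2) sine_coef n g k *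
    cos (k%:R * angle R n) ^+ t * sin (k%:R * angle R n * y%:R).
Proof.
move=> n0 g0 gn; elim: t y => [|t IH] y yn /=.
  have [iy|] := boolP (inner n y); last first.
    rewrite /inner negb_and -leqNgt leqn0 -leqNgt => /orP[/eqP ->|ny].
      by rewrite g0 big1// => k _; rewrite mulr0 sin0 mulr0.
    have -> : y = n.*2 by apply/eqP; rewrite eqn_leq yn.
    by rewrite gn big1// => k _; rewrite sin_angle_end// mulr0.
  under eq_bigr do rewrite expr0 mulr1 /sine_coef -[_ * _ * sin _]mulrA mulr_suml.
  rewrite -mulr_sumr exchange_big/=.
  under eq_bigr => z _.
    rewrite (_ : \sum_(_ < _) _ = g z * ((y == z)%:R * n%:R)); last first.
      have [z0|z0] := eqVneq (z : nat) 0%N.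
        by rewrite z0 g0 mul0r big1// => k _; rewrite !mul0r.
      rewrite -sum_sin_sin// /inner ?lt0n ?z0 ?ltn_ord// mulr_sumr.
      by apply: eq_bigr => k _; rewrite -mulrA; congr (_ * _); rewrite mulrC.
    over.
  have yn' : (y < n.*2)%N by case/andP: iy.
  rewrite (bigD1 (Ordinal yn'))//= eqxx mul1r big1 => [|z /eqP zy].
    by rewrite addr0 mulrCA mulVf ?mulr1// pnatr_eq0 -lt0n.
  by case: eqVneq => [yz|_]; [case: zy; exact: val_inj|rewrite mul0r mulr0].
rewrite /avg; case: ifPn => [|]; last first.
  rewrite /inner negb_and -leqNgt leqn0 -leqNgt => /orP[/eqP ->|ny].
    by rewrite big1// => k _; rewrite mulr0 sin0 mulr0.
  have -> : y = n.*2 by apply/eqP; rewrite eqn_leq yn.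
  by rewrite big1// => k _; rewrite sin_angle_end// mulr0.
case: y yn => // y yn /andP[_ yn']; rewrite !IH//=; last exact: ltnW.
rewrite -big_split/= mulr_suml; apply: eq_bigr => k _.
set b := _ * angle R n.
rewrite (_ : b * y%:R = b * y.+1%:R - b); last by rewrite -natr1; ring.
rewrite (_ : b * y.+2%:R = b * y.+1%:R + b); last by rewrite -[y.+2%:R]natr1; ring.
by rewrite sinB sinD exprS; field.
Qed.

End Spectral.

Lemma ler_cos (R : realType) :
  {in `[0, pi] &, {mono @cos R : x y /~ y <= x}}.
Proof. by move=> x y x0 y0; rewrite leNgt ltr_cos// -leNgt. Qed.

Section KilledWalk.
Variables (R : realType) (n : nat).
Hypothesis n2 : (1 < n)%N.
Local Notation a := (angle R n).
Local Notation lam := (cos a).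

Let n0 : (0 < n)%N. Proof. exact: ltnW. Qed.
Let nR0 : 0 < n%:R :> R. Proof. by rewrite ltr0n. Qed.
Let a0 : 0 < a. Proof. exact: angle_gt0. Qed.

Lemma angle_lt_pihalf : a < pi / 2.
Proof. by rewrite -(angle_pihalf _ n0) ltr_pMr// ltr1n. Qed.

Lemma cos_angle_gt0 : 0 < lam.
Proof.
apply: cos_gt0_pihalf; rewrite angle_lt_pihalf (lt_trans _ a0)//.
by rewrite oppr_lt0 divr_gt0// pi_gt0.
Qed.

Lemma cos_norm_le (u v : R) : 0 <= u -> u <= v -> v <= pi - u ->
  `|cos v| <= cos u.
Proof.
move=> u0 uv vu; rewrite ler_norml.
have p0 := pi_ge0 R.
have I x : 0 <= x -> x <= pi -> x \in `[0, pi :> R].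
  by move=> x0 xp; rewrite in_itv/= x0.
have Iv : v \in `[0, pi :> R] by apply: I; lra.
apply/andP; split; last by rewrite ler_cos//; apply: I; lra.
have -> : - cos u = cos (pi - u).
  by rewrite addrC cosDpi cosN.
by rewrite ler_cos//; apply: I; lra.
Qed.

(** Spectral gap for the middle modes, through cos 2a = 2 lam^2 - 1 <= lam^2. The bound by a power
    of [lam] gives these modes a further factor [lam ^+ t] relative to the principal one. *)
Lemma cos_angle_mid k : (1 < k < n.*2.-1)%N -> `|cos (k%:R * a)| <= lam ^+ 2.
Proof.
move=> /andP[k1 kn]; apply: (@le_trans _ _ (cos (2 * a))).
  apply: cos_norm_le; first by rewrite mulr_ge0// ltW.
    by rewrite ler_pM2r// (ler_nat _ 2).
  rewrite -(angle_pi R n0) -mulrBl ler_pM2r// lerBrDl -natrD ler_nat; lia.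
rewrite mulr_natl cos_mulr2n mulr2n.
have : lam ^+ 2 <= 1 by rewrite expr_le1 ?cos_le1// ltW// cos_angle_gt0.
lra.
Qed.

Lemma last_angle : n.*2.-1%:R * a = pi - a.
Proof.
rewrite -(angle_pi R n0) -[in RHS](@prednK n.*2) ?double_gt0// -natr1; ring.
Qed.

Lemma cos_last_angle : cos (n.*2.-1%:R * a) = - lam.
Proof. by rewrite last_angle addrC cosDpi cosN. Qed.

(** Bipartiteness: up to a global sign, the last mode is the principal sine times the alternating
    sign. *)
Lemma sin_last_angle y : sin (n.*2.-1%:R * a * y%:R) = - (-1) ^+ y * sin (a * y%:R).
Proof.
rewrite last_angle mulrBl sinB (mulrC pi) sin_natmul_pi cos_natmul_pi mul0r.
by rewrite sub0r mulNr.
Qed.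

Lemma iter_avg_approx (g : nat -> R) (B B' : R) t y :
  g 0%N = 0 -> g n.*2 = 0 -> (y <= n.*2)%N ->
  (forall k, (1 < k < n.*2.-1)%N -> `|sine_coef n g k| <= B) ->
  `|sine_coef n g n.*2.-1| <= B' ->
  `|iter t (avg n) g y - sine_coef n g 1 * lam ^+ t * sin (a * y%:R)| <=
  lam ^+ t * (B' + n.*2%:R * B * lam ^+ t).
Proof.
move=> g0 gn yn gB gB'; rewrite iter_avgE//.
have l0 := cos_angle_gt0.
rewrite -(big_mkord xpredT (fun k => sine_coef n g k * cos (k%:R * a) ^+ t *
  sin (k%:R * a * y%:R))).
rewrite big_ltn ?double_gt0// big_ltn; last by lia.
rewrite mul0r mul0r sin0 mulr0 add0r mul1r addrAC subrr add0r.
have N2 : n.*2 = n.*2.-1.+1 by lia.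
rewrite [X in index_iota _ X]N2 big_nat_recr/=; last by lia.
rewrite (le_trans (ler_normD _ _))// [in leRHS]addrC [in leRHS]mulrDr.
apply: lerD; last first.
  move: (sine_coef _ _ n.*2.-1) gB' => c gB'.
  rewrite cos_last_angle !normrM normrX normrN (ger0_norm (ltW l0)).
  rewrite [leRHS]mulrC -[leRHS]mulr1.
  apply: ler_pM; rewrite ?sin_max ?mulr_ge0 ?exprn_ge0 ?(ltW l0)//.
  by rewrite ler_wpM2r// exprn_ge0// ltW.
rewrite (le_trans (ler_norm_sum _ _ _))//.
apply: (@le_trans _ _ (\sum_(2 <= k < n.*2.-1) B * (lam ^+ t * lam ^+ t))).
  apply: ler_sum_nat => k kn.
  have B0 : 0 <= B by apply: le_trans (gB k kn).
  move: (sine_coef _ _ k) (gB k kn) => c cB.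
  rewrite !normrM -[leRHS]mulr1; apply: ler_pM; rewrite ?sin_max ?mulr_ge0//.
  apply: ler_pM => //; rewrite normrX -exprMn -expr2.
  by apply: lerXn2r; rewrite ?nnegrE ?sqr_ge0// cos_angle_mid.
rewrite sumr_const_nat -[leLHS]mulr_natr.
rewrite [leRHS](_ : _ = B * (lam ^+ t * lam ^+ t) * n.*2%:R); last by ring.
have [n2'|n2'] := ltnP 2 n.*2.-1; last first.
  by lia.
have B0 : 0 <= B by apply: (@le_trans _ _ `|sine_coef n g 2|) => //; apply: gB; rewrite n2'.
rewrite ler_wpM2l ?ler_nat ?mulr_ge0 ?exprn_ge0//; try lia.
all: exact: ltW.
Qed.

Definition inside y : R := (inner n y)%:R.

Lemma sine_coef_inside_le k : `|sine_coef n inside k| <= 2.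
Proof.
rewrite /sine_coef normrM normfV normr_nat.
rewrite ler_pdivrMl// (le_trans (ler_norm_sum _ _ _))//.
apply: (@le_trans _ _ (\sum_(y < n.*2) 1)); last first.
  by rewrite sumr_const card_ord -mul2n natrM mulrC.
apply: ler_sum => y _; rewrite normrM mulr_ile1 ?sin_max//.
by rewrite /inside; case: inner; rewrite ?normr1 ?normr0.
Qed.

Lemma sum_sin_alternating N :
  2 * cos (a / 2) * \sum_(y < N) (-1) ^+ y * sin (a * y%:R) =
  - sin (a / 2) - (-1) ^+ N * sin (a * N%:R - a / 2).
Proof.
elim: N => [|N IH].
  by rewrite big_ord0 !mulr0 expr0 sub0r sinN; ring.
rewrite big_ord_recr/= mulrDr IH exprS.
have -> : a * N.+1%:R - a / 2 = a * N%:R + a / 2 by rewrite -natr1; field.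
rewrite sinB sinD; ring.
Qed.

(** The alternating sum of sines telescopes after multiplication by [2 * cos (a / 2)], a factor at
    least 1, so it is bounded by 2 uniformly in [n]. *)
Lemma sine_coef_inside_last : `|sine_coef n inside n.*2.-1| <= 2 / n%:R.
Proof.
rewrite /sine_coef normrM normfV normr_nat.
rewrite mulrC ler_pM2r ?invr_gt0//.
have -> : \sum_(y < n.*2) inside y * sin (n.*2.-1%:R * a * y%:R) =
    - \sum_(y < n.*2) (-1) ^+ y * sin (a * y%:R).
  rewrite -sumrN; apply: eq_bigr => y _; rewrite sin_last_angle /inside /inner.
  rewrite ltn_ord andbT; case: posnP => [->|_]; last by rewrite mul1r mulNr.
  by rewrite mulr0 sin0 !mulr0 oppr0.
rewrite normrN.
have c0 : 0 < cos (a / 2).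
  apply: cos_gt0_pihalf; have := angle_lt_pihalf; have := a0; have := pi_gt0 R.
  by move=> *; apply/andP; split; lra.
(* 2 cos^2 (a / 2) = 1 + cos a > 1, and cos^2 <= cos here. *)
have c1 : 1 <= 2 * cos (a / 2).
  have := cos_mulr2n (a / 2); rewrite mulr2n -splitr mulr2n => E.
  have : cos (a / 2) ^+ 2 <= cos (a / 2).
    by rewrite expr2 ger_pMr// cos_le1.
  have := cos_angle_gt0; lra.
set S := \sum_(_ < _) _.
apply: (@le_trans _ _ (`|2 * cos (a / 2) * S|)).
  by rewrite normrM ler_peMl// ger0_norm// (le_trans _ c1).
rewrite sum_sin_alternating (le_trans (ler_normB _ _))// normrN normrM normrX.
rewrite normrN1 expr1n mul1r (_ : 2 = 1 + 1)//; apply: lerD; exact: sin_max.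
Qed.

Lemma iter_avg_inside t y : (y <= n.*2)%N ->
  `|iter t (avg n) inside y - sine_coef n inside 1 * lam ^+ t * sin (a * y%:R)|
  <= lam ^+ t * (2 / n%:R + n.*2%:R * 2 * lam ^+ t).
Proof.
move=> yn; apply: iter_avg_approx => //; rewrite ?sine_coef_inside_last//.
- by rewrite /inside /inner ltnn andbF.
- by move=> k _; exact: sine_coef_inside_le.
Qed.

Lemma sin_angle_ge y : inner n y -> sin a <= sin (a * y%:R).
Proof.
(* sin u = cos |u - pi / 2|, and among the angles of the interior sites [a] is as far as possible
   from pi / 2. *)
move=> /andP[y0 yn]; rewrite -(cosBpihalf a) -(cosBpihalf (a * _)).
have ay : a <= a * y%:R by rewrite ler_peMr ?ler1n// ltW.
have ay' : a * y%:R <= pi - a.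
  rewrite -(angle_pi R n0) (_ : _ - a = a * (n.*2%:R - 1)); last by ring.
  rewrite ler_pM2l// -(@natrB _ _ 1) ?double_gt0// ler_nat; lia.
have H := angle_lt_pihalf; have a0' := a0; have p0 := pi_gt0 R.
rewrite -[X in X <= _]cosN -[X in _ <= X]cos_norm.
rewrite ler_cos ?in_itv/=.
- by rewrite ler_norml; apply/andP; split; lra.
- by rewrite normr_ge0/= ler_norml; apply/andP; split; lra.
- by apply/andP; split; lra.
Qed.

Lemma sin_angle_gt0 : 0 < sin a.
Proof.
by apply: sin_gt0_pihalf; rewrite a0 angle_lt_pihalf.
Qed.

Definition inv_sine y : R := if inner n y then (sin (a * y%:R))^-1 else 0.

(** Against the principal sine the singularity cancels: each term of the coefficient is 1, so the
    coefficient is at most 2, and the same holds for the last mode up to sign; together they give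
    the 4. The middle coefficients may be as large as [2 / sin a], of order n, but they are
    damped. *)
Lemma iter_avg_inv_sine t :
  iter t (avg n) inv_sine n <=
  lam ^+ t * (4 + n.*2%:R * (2 / sin a) * lam ^+ t).
Proof.
have s0 := sin_angle_gt0.
have coef k (C : R) : (forall y, inner n y ->
    `|sin (k%:R * a * y%:R)| <= C * sin (a * y%:R)) -> 0 <= C ->
    `|sine_coef n inv_sine k| <= 2 * C.
  move=> H C0; rewrite /sine_coef normrM normfV normr_nat.
  rewrite ler_pdivrMl// (le_trans (ler_norm_sum _ _ _))//.
  apply: (@le_trans _ _ (\sum_(y < n.*2) C)); last first.
    by rewrite sumr_const card_ord -[leLHS]mulr_natl -mul2n natrM mulrCA mulrA.
  apply: ler_sum => y _; rewrite normrM /inv_sine; case: ifPn => [iy|].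
    have sy : 0 < sin (a * y%:R) := lt_le_trans s0 (sin_angle_ge iy).
    by rewrite normfV (ger0_norm (ltW sy)) ler_pdivrMl// [leRHS]mulrC H.
  by rewrite normr0 mul0r.
have c1 : `|sine_coef n inv_sine 1| <= 2.
  rewrite -[leRHS]mulr1; apply: coef => // y iy; rewrite !mul1r ger0_norm//.
  by rewrite (le_trans (ltW s0))// sin_angle_ge.
have cl : `|sine_coef n inv_sine n.*2.-1| <= 2.
  rewrite -[leRHS]mulr1; apply: coef => // y iy.
  rewrite sin_last_angle mul1r normrM normrN normrX normrN1 expr1n mul1r ger0_norm//.
  by rewrite (le_trans (ltW s0))// sin_angle_ge.
have cB k : `|sine_coef n inv_sine k| <= 2 / sin a.
  apply: coef => [y iy|]; last by rewrite invr_ge0 ltW.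
  rewrite (le_trans (sin_max _))// mulrC ler_pdivlMr// mul1r.
  exact: sin_angle_ge.
have nn : (n <= n.*2)%N by lia.
have i0 : inv_sine 0 = 0 by [].
have in2 : inv_sine n.*2 = 0 by rewrite /inv_sine /inner ltnn andbF.
have := iter_avg_approx t i0 in2 nn (fun k _ => cB k) cl.
rewrite angle_pihalf// sin_pihalf mulr1 => /(le_trans (ler_norm _)).
have l0 : 0 < lam ^+ t by rewrite exprn_gt0// cos_angle_gt0.
have : sine_coef n inv_sine 1 * lam ^+ t <= 2 * lam ^+ t.
  by rewrite ler_pM2r// (le_trans (ler_norm _)).
lra.
Qed.

End KilledWalk.

(** * The walk weighted at a site *)

Section WeightedWalk.
Variables (R : realType) (n : nat).
Implicit Types (w f g : nat -> R).

Lemma avg_lin (c : R) f g :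
  avg n (fun y => c * f y + g y) = fun y => c * avg n f y + avg n g y.
Proof.
apply/funext => y; rewrite /avg; case: inner; last by rewrite mulr0 addr0.
by field.
Qed.

Lemma iter_wavg_lin w t (c : R) f g :
  iter t (wavg n w) (fun y => c * f y + g y) =
  fun y => c * iter t (wavg n w) f y + iter t (wavg n w) g y.
Proof.
elim: t => // t IH; rewrite !iterS IH /wavg -avg_lin; congr avg.
by apply/funext => y; ring.
Qed.

Lemma wavg1 : wavg n (fun=> 1) = avg n :> ((nat -> R) -> nat -> R).
Proof.
by apply/funext => f; rewrite /wavg; congr avg; apply/funext => y; rewrite mul1r.
Qed.

Lemma avg_le f g y : (forall z, (z <= n.*2)%N -> f z <= g z) ->
  avg n f y <= avg n g y.
Proof.
move=> fg; rewrite /avg; case: ifPn => // /andP[y0 yn].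
by rewrite ler_pM2r// lerD// fg//; lia.
Qed.

Lemma iter_wavg_le w t f g y : (forall z, 0 <= w z) ->
  (forall z, (z <= n.*2)%N -> f z <= g z) -> (y <= n.*2)%N ->
  iter t (wavg n w) f y <= iter t (wavg n w) g y.
Proof.
move=> w0 fg; elim: t y => [|t IH] y yn; first exact: fg.
by rewrite !iterS; apply: avg_le => z zn; rewrite ler_wpM2l// IH.
Qed.

Lemma iter_wavg0 w t : iter t (wavg n w) (fun=> 0) = fun=> 0.
Proof.
elim: t => // t IH; rewrite iterS IH; apply/funext => y.
by rewrite /wavg /avg !mulr0 addr0 mul0r if_same.
Qed.

Lemma iter_wavg_ge0 w t f y : (forall z, 0 <= w z) ->
  (forall z, (z <= n.*2)%N -> 0 <= f z) -> (y <= n.*2)%N ->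
  0 <= iter t (wavg n w) f y.
Proof.
by move=> w0 f0 yn; have := iter_wavg_le t w0 f0 yn; rewrite iter_wavg0.
Qed.

Lemma iter_wavg_le_avg w t f y : (forall z, 0 <= w z <= 1) ->
  (forall z, (z <= n.*2)%N -> 0 <= f z) -> (y <= n.*2)%N ->
  iter t (wavg n w) f y <= iter t (avg n) f y.
Proof.
move=> w01 f0; elim: t y => // t IH y yn; rewrite !iterS; apply: avg_le => z zn.
have [w0 w1] := andP (w01 z).
apply: le_trans (IH z zn); apply: ler_piMl => //.
by apply: iter_wavg_ge0 => // v; case/andP: (w01 v).
Qed.

Lemma iter_wavg_eigen w (mu : R) f t y :
  (forall z, (z <= n.*2)%N -> wavg n w f z = mu * f z) -> (y <= n.*2)%N ->
  iter t (wavg n w) f y = mu ^+ t * f y.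
Proof.
move=> H; elim: t y => [|t IH] y yn; first by rewrite expr0 mul1r.
rewrite iterS /wavg exprS -mulrA mulrCA -H//.
rewrite /wavg /avg; case: ifPn => [/andP[y0 yn']|_]; last by rewrite mulr0.
by rewrite !IH; [field|lia|lia].
Qed.

Hypothesis n2 : (1 < n)%N.
Local Notation a := (angle R n).
Local Notation lam := (cos a).

Definition sine y : R := sin (a * y%:R).

Lemma sine0 : sine 0 = 0. Proof. by rewrite /sine mulr0 sin0. Qed.
Lemma sine_end : sine n.*2 = 0.
Proof. by rewrite /sine mulrC angle_pi ?sinpi// ltnW. Qed.

Lemma sine_ge0 y : (y <= n.*2)%N -> 0 <= sine y.
Proof.
move=> yn; have a0 := angle_gt0 R (ltnW n2); apply: sin_ge0_pi.
rewrite mulr_ge0 ?(ltW a0)//= -(angle_pi R (ltnW n2)) mulrC.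
by rewrite ler_pM2r// ler_nat.
Qed.

Lemma avg_sine y : (y <= n.*2)%N -> avg n sine y = lam * sine y.
Proof.
move=> yn; rewrite /avg; case: ifPn => [|].
  case: y yn => // y yn _; rewrite /sine/=.
  rewrite (_ : a * y%:R = a * y.+1%:R - a); last by rewrite -natr1; ring.
  rewrite (_ : a * y.+2%:R = a * y.+1%:R + a); last by rewrite -[y.+2%:R]natr1; ring.
  by rewrite sinB sinD; field.
rewrite /inner negb_and -leqNgt leqn0 -leqNgt => /orP[/eqP ->|ny].
  by rewrite sine0 mulr0.
have -> : y = n.*2 by apply/eqP; rewrite eqn_leq yn.
by rewrite sine_end mulr0.
Qed.

Lemma iter_avg_sine t y : (y <= n.*2)%N ->
  iter t (avg n) sine y = lam ^+ t * sine y.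
Proof.
by rewrite -wavg1; apply: iter_wavg_eigen => z; rewrite wavg1; exact: avg_sine.
Qed.

Lemma iter_avg_end t f : f 0%N = 0 -> f n.*2 = 0 ->
  iter t (avg n) f 0 = 0 /\ iter t (avg n) f n.*2 = 0.
Proof.
move=> f0 fn; case: t => // t; rewrite !iterS /avg /inner ltnn andbF.
by [].
Qed.

(** Changing the final weight by at most [e] costs at most [e] times the survival probability: [f]
    lies between two multiples of the indicator of the interior, and both the iteration and the
    removal of the weights are monotone. *)
Lemma iter_wavg_sup w (e : R) f t y : (forall z, 0 <= w z <= 1) -> 0 <= e ->
  f 0%N = 0 -> f n.*2 = 0 -> (forall z, (z <= n.*2)%N -> `|f z| <= e) ->
  (y <= n.*2)%N ->
  `|iter t (wavg n w) f y| <= e * iter t (avg n) (inside R n) y.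
Proof.
move=> w01 e0 f0 fn fe yn; set W := wavg n w; set one := inside R n.
have w0 z : 0 <= w z by case/andP: (w01 z).
have lin (b : R) g h : iter t W (fun y => b * g y + h y) y =
  b * iter t W g y + iter t W h y by rewrite iter_wavg_lin.
have fle z : (z <= n.*2)%N -> `|f z| <= e * one z.
  move=> zn; have [iz|] := boolP (inner n z).
    by rewrite /one /inside iz mulr1 fe.
  rewrite /inner negb_and -leqNgt leqn0 -leqNgt => /orP[/eqP ->|nz].
    by rewrite f0 normr0 mulr_ge0// ler0n.
  have -> : z = n.*2 by apply/eqP; rewrite eqn_leq zn.
  by rewrite fn normr0 mulr_ge0// ler0n.
have cst : iter t W (fun y => e * one y) y = e * iter t W one y.
  have := lin e one (fun=> 0); rewrite iter_wavg0 addr0 => <-.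
  by congr (iter _ _ _ _); apply/funext => z; rewrite addr0.
have Wone : iter t W one y <= iter t (avg n) one y.
  by apply: iter_wavg_le_avg => // z _; rewrite ler0n.
rewrite (@le_trans _ _ (e * iter t W one y))//; last by rewrite ler_wpM2l.
rewrite ler_norml -cst; apply/andP; split; last first.
  by apply: iter_wavg_le => // z zn; rewrite (le_trans _ (fle z zn))// ler_norm.
rewrite -subr_ge0 opprK -[X in _ + X]mul1r addrC -lin.
apply: iter_wavg_ge0 => // z zn; rewrite mul1r.
have := fle z zn; rewrite ler_norml => /andP[]; lra.
Qed.

(** Two errors: during the last [s] steps, survival is compared with the principal sine ([H1]), and
    the weights dropped there are paid for ([H2]). The parameter [K] is free, to be chosen after the
    limit in [n]. *)
Lemma iter_wavg_split w (c K eta : R) r s : (forall z, 0 <= w z <= 1) -> 0 < K ->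
  (forall y, (y <= n.*2)%N ->
    `|iter s (avg n) (inside R n) y - c * lam ^+ s * sine y| <= eta) ->
  `|iter (r + s) (wavg n w) (inside R n) n
      - c * lam ^+ s * iter r (wavg n w) sine n| <=
  eta * iter r (avg n) (inside R n) n
  + K / 2 * (lam ^+ s * iter r (wavg n w) sine n
             - iter (r + s) (wavg n w) sine n)
  + (2 * K)^-1 * iter (r + s) (avg n) (inv_sine R n) n.
Proof.
move=> w01 K0 Hs; set one := inside R n.
have w0 z : 0 <= w z by case/andP: (w01 z).
have nn : (n <= n.*2)%N by lia.
have eta0 : 0 <= eta by apply: le_trans (Hs n nn).
have one0 z : (z <= n.*2)%N -> 0 <= one z by rewrite /one/inside ler0n.
have oneE0 : one 0%N = 0 by [].
have oneEn : one n.*2 = 0 by rewrite /one/inside /inner ltnn andbF.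
set W := wavg n w.
have lin t (b : R) f g : iter t W (fun y => b * f y + g y) n =
  b * iter t W f n + iter t W g n by rewrite iter_wavg_lin.
have H1 : `|iter r W (iter s (avg n) one) n - c * lam ^+ s * iter r W sine n|
    <= eta * iter r (avg n) one n.
  set f := fun y => - (c * lam ^+ s) * sine y + iter s (avg n) one y.
  have -> : iter r W (iter s (avg n) one) n - c * lam ^+ s * iter r W sine n
     = iter r W f n by rewrite lin; ring.
  have [e0 en] := iter_avg_end s oneE0 oneEn.
  apply: iter_wavg_sup => //.
  - by rewrite /f sine0 e0 mulr0 addr0.
  - by rewrite /f sine_end en mulr0 addr0.
  - by move=> y yn; rewrite /f addrC mulNr; exact: Hs.
have H2 : iter r W (iter s (avg n) one) n - iter (r + s) W one n <=
    K / 2 * (lam ^+ s * iter r W sine n - iter (r + s) W sine n)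
  + (2 * K)^-1 * iter (r + s) (avg n) (inv_sine R n) n.
  (* AM-GM: 1 <= K / 2 * sine y + (2 K)^-1 / sine y *)
  set g := fun y => K / 2 * sine y + ((2 * K)^-1 * inv_sine R n y + - 1 * one y).
  have g0 y : (y <= n.*2)%N -> 0 <= g y.
    move=> yn; rewrite /g /one /inside /inv_sine; case: ifPn => iy.
      have s0 : 0 < sine y.
        by rewrite (lt_le_trans (sin_angle_gt0 R n2))// sin_angle_ge.
      rewrite -/(sine y); set u := sine y in s0 *.
      have -> : K / 2 * u + ((2 * K)^-1 / u + -1 * 1) = (K * u - 1) ^+ 2 / (2 * K * u).
        by field; rewrite !gt_eqF.
      by rewrite divr_ge0 ?sqr_ge0// !mulr_ge0// ltW.
    by rewrite !mulr0 !addr0 mulr_ge0 ?sine_ge0// divr_ge0// ltW.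
  (* The difference of the unweighted and weighted [s]-step operators is positive. Applied to
     [g >= 0], it turns the pointwise inequality into one between losses. *)
  have D0 y : (y <= n.*2)%N -> 0 <= -1 * iter s W g y + iter s (avg n) g y.
    by move=> yn; rewrite mulN1r addrC subr_ge0 iter_wavg_le_avg.
  have := iter_wavg_ge0 r w0 D0 nn; rewrite lin -iterD.
  have -> : iter s (avg n) g = fun y => K / 2 * iter s (avg n) sine y +
     ((2 * K)^-1 * iter s (avg n) (inv_sine R n) y + - 1 * iter s (avg n) one y).
    rewrite -wavg1 /g iter_wavg_lin; apply/funext => y; congr (_ + _).
    rewrite iter_wavg_lin; congr (_ + _).
    have := iter_wavg_lin (fun=> 1) s (-1) one (fun=> 0).
    rewrite iter_wavg0 => /(congr1 (fun h => h y)); rewrite addr0 => <-.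
    by congr (iter _ _ _ _); apply/funext => z; rewrite addr0.
  have N1 t f : iter t W (fun y => - 1 * f y) n = - iter t W f n.
    have := lin t (-1) f (fun=> 0); rewrite iter_wavg0 addr0 mulN1r => <-.
    by congr (iter _ _ _ _); apply/funext => y; rewrite addr0.
  rewrite !lin !N1 /g.
  have -> : iter r W (iter s (avg n) sine) n = lam ^+ s * iter r W sine n.
    have := lin r (lam ^+ s) sine (fun=> 0); rewrite iter_wavg0 addr0 => <-.
    apply: le_anti; apply/andP; split; apply: iter_wavg_le => // z zn;
      by rewrite iter_avg_sine// addr0.
  have inv0 z : (z <= n.*2)%N -> 0 <= inv_sine R n z.
    move=> zn; rewrite /inv_sine; case: ifP => // _.
    by rewrite invr_ge0 sine_ge0.
  have : (2 * K)^-1 * iter r W (iter s (avg n) (inv_sine R n)) n <=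
      (2 * K)^-1 * iter (r + s) (avg n) (inv_sine R n) n.
    rewrite ler_pM2l ?invr_gt0 ?mulr_gt0// iterD.
    apply: iter_wavg_le_avg => // z zn; rewrite -wavg1.
    by apply: iter_wavg_ge0.
  have : 0 <= (2 * K)^-1 * iter (r + s) W (inv_sine R n) n.
    rewrite mulr_ge0 ?invr_ge0 ?mulr_ge0 ?(ltW K0)//.
    by apply: iter_wavg_ge0.
  rewrite mulrBr; lra.
have H3 : iter (r + s) W one n <= iter r W (iter s (avg n) one) n.
  rewrite iterD; apply: iter_wavg_le => // z zn; exact: iter_wavg_le_avg.
rewrite -[X in `|X|](subrKA (iter r W (iter s (avg n) one) n)).
rewrite (le_trans (ler_normD _ _))// addrC -addrA; apply: lerD => //.
by rewrite ler0_norm ?subr_le0// opprB.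
Qed.

End WeightedWalk.

(* The eigenfunction vanishes at 0 and at 2n; the weight [tilt_weight] at [x] is
   what makes up for its kink there. *)
Section Tilt.
Variables (R : realType) (n x : nat) (kappa : R).
Hypotheses (x0 : (0 < x)%N) (xn : (x < n)%N).

Definition tilt_angle : R := pi / (n.*2%:R - kappa).
Local Notation th := tilt_angle.

(** The factor in the first branch makes the two sines agree at [x]. *)
Definition tilt y : R := if (y <= x)%N
  then sin (th * (x%:R - kappa)) / sin (th * x%:R) * sin (th * y%:R)
  else sin (th * (y%:R - kappa)).

Definition tilt_weight : R := cos th * tilt x / ((tilt x.-1 + tilt x.+1) / 2).

Definition site_weight (z : R) y : R := if y == x then z else 1.

Hypothesis kn : kappa < n.*2%:R.
Hypothesis sx : sin (th * x%:R) != 0.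
Hypothesis w0 : tilt_weight != 0.

(** [wavg] multiplies its argument by the weight, so the eigenfunction is [tilt] divided by the
    weight and the claim concerns [avg n tilt]: away from [x] it is the addition formula, at [x] it
    is the equation that [tilt_weight] solves. *)
Lemma wavg_tilt y : (y <= n.*2)%N ->
  wavg n (site_weight tilt_weight) (fun y => tilt y / site_weight tilt_weight y) y
  = cos th * (tilt y / site_weight tilt_weight y).
Proof.
move=> yn; set w := site_weight _.
have wn z : w z != 0 by rewrite /w /site_weight; case: (z == x) => //; exact: oner_neq0.
have -> : wavg n w (fun y => tilt y / w y) = avg n tilt.
  by rewrite /wavg; congr avg; apply/funext => z; rewrite mulrC divfK.
have t0 : tilt 0 = 0 by rewrite /tilt leq0n mulr0 sin0 mulr0.
have tn : tilt n.*2 = 0.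
  rewrite /tilt leqNgt (_ : x < n.*2)%N/=; last by lia.
  by rewrite /th divfK ?sinpi// gt_eqF// subr_gt0.
rewrite /avg; case: ifPn => [/andP[]|]; last first.
  rewrite /inner negb_and -leqNgt leqn0 -leqNgt => /orP[/eqP ->|ny].
    by rewrite t0 mul0r mulr0.
  have -> : y = n.*2 by apply/eqP; rewrite eqn_leq yn.
  by rewrite tn mul0r mulr0.
case: y yn => // y yn _ yn'; rewrite /= /w /site_weight; case: eqP => [yx|/eqP yx].
  rewrite /tilt_weight -yx/=; set T := tilt y.+1; set A := (_ + _) / 2.
  have : tilt_weight != 0 by [].
  rewrite /tilt_weight -yx /= -/T -/A mulf_eq0 invr_eq0 negb_or mulf_eq0 negb_or.
  by move=> /andP[/andP[c0 T0] A0]; clearbody T A; field; rewrite A0 c0 T0.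
have sh c : sin (th * (c - 1)) + sin (th * (c + 1)) = 2 * cos th * sin (th * c).
  by rewrite mulrBr mulrDr mulr1 sinB sinD; ring.
rewrite divr1 /tilt; have [xy|yx'] := ltnP x y.
  have -> : (y.+2 <= x)%N = false by lia.
  have -> : (y.+1 <= x)%N = false by lia.
  have := sh (y.+1%:R - kappa).
  rewrite (_ : y.+1%:R - kappa - 1 = y%:R - kappa); last by rewrite -natr1; ring.
  rewrite (_ : y.+1%:R - kappa + 1 = y.+2%:R - kappa); last by rewrite -[y.+2%:R]natr1; ring.
  by move=> ->; field.
have [y1x|xy1] := leqP y.+1 x.
  have -> : (y.+2 <= x)%N by rewrite ltn_neqAle yx.
  rewrite -mulrDr.
  have := sh y.+1%:R; rewrite -[in X in X - 1]natr1 addrK natr1 => ->.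
  by field.
(* The site just above [x]: its left neighbour is [x] itself, where the first branch may be traded
   for the second. *)
have xy : x = y by lia.
have -> : (y.+2 <= x)%N = false by lia.
have := sh (y.+1%:R - kappa).
rewrite (_ : y.+1%:R - kappa - 1 = y%:R - kappa); last by rewrite -natr1; ring.
rewrite (_ : y.+1%:R - kappa + 1 = y.+2%:R - kappa); last by rewrite -[y.+2%:R]natr1; ring.
by rewrite -xy divfK//; move=> ->; field.
Qed.

End Tilt.

(** * Limits *)

Section Limits.
Variable R : realType.
Implicit Types (u v f g : nat -> R) (k l c : R).

Lemma cvg0_le f g : (\forall n \near \oo, `|f n| <= g n) ->
  g n @[n --> \oo] --> (0 : R) -> f n @[n --> \oo] --> (0 : R).
Proof.
move=> fg g0; have gN : (- g n) @[n --> \oo] --> (0 : R).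
  by rewrite -oppr0; apply: cvgN.
apply: squeeze_cvgr gN g0; near=> n; rewrite -ler_norml; near: n; exact: fg.
Unshelve. all: by end_near. Qed.

Lemma cvg_of_sub f g l : (f n - g n) @[n --> \oo] --> (0 : R) ->
  g n @[n --> \oo] --> l -> f n @[n --> \oo] --> l.
Proof.
move=> fg gl; rewrite (_ : f = fun n => (f n - g n) + g n); last first.
  by apply/funext => n; rewrite subrK.
by rewrite -[l]add0r; apply: cvgD.
Qed.

Lemma invn_cvg0 : (n%:R^-1 : R) @[n --> \oo] --> (0 : R).
Proof. by rewrite -cvg_shiftS; exact: cvg_harmonic. Qed.

Lemma sin_lipschitz (x y : R) : `|sin x - sin y| <= `|x - y|.
Proof.
wlog xy : x y / x < y => [H|].
  have [xy|xy|->] := ltgtP x y; [exact: H| |by rewrite !subrr].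
  by rewrite distrC [leRHS]distrC; exact: H.
have [|c _ E] := MVT xy (fun z _ => is_derive_sin z).
  by apply: continuous_subspaceT => z; exact: continuous_sin.
by rewrite distrC E normrM [leRHS]distrC ler_piMl// cos_max.
Qed.

Lemma sin_le_norm (x : R) : `|sin x| <= `|x|.
Proof. by have := sin_lipschitz x 0; rewrite sin0 !subr0. Qed.

Lemma cos_sub1_le (x : R) : `|cos x - 1| <= `|x|.
Proof.
have := sin_lipschitz (x + pi / 2) (pi / 2).
by rewrite sinDpihalf sin_pihalf addrK.
Qed.

Lemma sin_sub_le (x : R) : `|sin x - x| <= x ^+ 2.
Proof.
wlog x0 : x / 0 < x => [H|].
  have [x0|x0|->] := ltgtP x 0; [|exact: H|by rewrite sin0 subr0 normr0 sqr_ge0].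
  have := H (- x); rewrite sinN -opprD normrN sqrrN; apply; lra.
have [|c cI E] := MVT x0 (fun z _ => is_derive_sin z).
  by apply: continuous_subspaceT => z; exact: continuous_sin.
move: E; rewrite sin0 !subr0 => ->.
rewrite -[X in _ - X]mul1r -mulrBl normrM (gtr0_norm x0) expr2 ler_pM2r//.
move: cI; rewrite in_itv/= => /andP[c0 cx].
by rewrite (le_trans (cos_sub1_le _))// gtr0_norm// ltW.
Qed.

(** The error of sin v ~ v is at most v^2, so it contributes |u v| |v|, which vanishes even when [u]
    is unbounded. *)
Lemma mul_sin_cvg u v l : (u n * v n) @[n --> \oo] --> l ->
  v n @[n --> \oo] --> (0 : R) -> (u n * sin (v n)) @[n --> \oo] --> l.
Proof.
move=> uv v0; apply: cvg_of_sub (uv).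
have lim0 : (`|u n * v n| * `|v n|) @[n --> \oo] --> (0 : R).
  rewrite -[X in _ --> X](mulr0 `|l|); apply: cvgM; first exact: cvg_norm.
  by rewrite -(normr0 R); exact: cvg_norm.
apply: cvg0_le lim0; apply: nearW => n.
rewrite -mulrBr !normrM -mulrA ler_wpM2l// (le_trans (sin_sub_le _))//.
by rewrite -normrM -expr2 ger0_norm// sqr_ge0.
Qed.

Lemma cos_cvg1 v : v n @[n --> \oo] --> (0 : R) -> cos (v n) @[n --> \oo] --> (1 : R).
Proof. by move=> v0; rewrite -(cos0 R); apply: continuous_cvg => //; exact: continuous_cos. Qed.

Lemma expr_cvg_expR (d : nat -> R) (r : nat -> nat) c :
  d n @[n --> \oo] --> (0 : R) -> ((r n)%:R * d n) @[n --> \oo] --> c ->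
  ((1 - d n) ^+ r n) @[n --> \oo] --> expR (- c).
Proof.
move=> d0 rd.
have up : expR (- ((r n)%:R * d n)) @[n --> \oo] --> expR (- c).
  by apply: continuous_cvg; [exact: continuous_expR|exact: cvgN].
have lo : expR (- ((r n)%:R * d n / (1 - d n))) @[n --> \oo] --> expR (- c).
  apply: continuous_cvg; first exact: continuous_expR.
  apply: cvgN; rewrite -[X in _ --> X]divr1; apply: cvgM => //.
  apply: cvgV; first exact: oner_neq0.
  by rewrite -[X in _ --> X]subr0; apply: cvgB => //; exact: cvg_cst.
apply: squeeze_cvgr lo up; near=> n.
have d1 : 0 < 1 - d n.
  rewrite subr_gt0; near: n; apply: (cvgr_lt 0) => //; exact: ltr01.
have E (y : R) : expR (y * (r n)%:R) = expR y ^+ r n.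
  by rewrite -expRM_natr.
apply/andP; split.
  rewrite (_ : - ((r n)%:R * d n / (1 - d n)) = - (d n / (1 - d n)) * (r n)%:R); last by ring.
  rewrite E lerXn2r ?nnegrE ?expR_ge0 ?(ltW d1)//.
  (* Lower bound from 1 / (1 - d) = 1 + d / (1 - d) <= exp (d / (1 - d)). *)
  rewrite expRN invf_ple ?posrE ?expR_gt0//.
  apply: le_trans (expR_ge1Dx _); rewrite le_eqVlt; apply/orP; left; apply/eqP.
  by field; rewrite gt_eqF.
rewrite (_ : - ((r n)%:R * d n) = - d n * (r n)%:R); last by ring.
rewrite E lerXn2r ?nnegrE ?expR_ge0 ?(ltW d1)//.
exact: expR_ge1Dx.
Unshelve. all: by end_near. Qed.

Lemma tilt_angle_cvg k : (n%:R * tilt_angle n k) @[n --> \oo] --> pi / 2.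
Proof.
have H : (pi / (2 - k * n%:R^-1)) @[n --> \oo] --> pi / 2.
  apply: cvgM; first exact: cvg_cst.
  apply: cvgV; first by rewrite pnatr_eq0.
  rewrite -[X in _ --> X]subr0 -(mulr0 k); apply: cvgB; first exact: cvg_cst.
  by apply: cvgM; [exact: cvg_cst|exact: invn_cvg0].
apply: cvg_trans H; apply: near_eq_cvg; near=> n.
have n0 : 0 < n%:R :> R by rewrite ltr0n; near: n; exact: nbhs_infty_gt.
rewrite /tilt_angle -mul2n natrM (_ : 2 * n%:R - k = n%:R * (2 - k * n%:R^-1)).
  by rewrite invfM [RHS]mulrCA mulVKf// gt_eqF.
by field; rewrite gt_eqF.
Unshelve. all: by end_near. Qed.

Lemma tilt_angle_cvg0 k c : (tilt_angle n k * c) @[n --> \oo] --> (0 : R).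
Proof.
have H : (n%:R^-1 * (n%:R * tilt_angle n k) * c) @[n --> \oo] --> (0 : R).
  rewrite -[X in _ --> X](mul0r c); apply: cvgM; last exact: cvg_cst.
  rewrite -[X in _ --> X](mul0r (pi / 2)); apply: cvgM; first exact: invn_cvg0.
  exact: tilt_angle_cvg.
apply: cvg_trans H; apply: near_eq_cvg; near=> n.
have n0 : 0 < n%:R :> R by rewrite ltr0n; near: n; exact: nbhs_infty_gt.
by rewrite mulKf// gt_eqF.
Unshelve. all: by end_near. Qed.

Lemma angleE : angle R = fun n => tilt_angle n 0.
Proof. by apply/funext => n; rewrite /tilt_angle subr0. Qed.

Lemma sin_tilt_angle_cvg k c :
  (n%:R * sin (tilt_angle n k * c)) @[n --> \oo] --> pi / 2 * c.
Proof.
apply: mul_sin_cvg; last exact: tilt_angle_cvg0.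
under eq_cvg do rewrite mulrA.
by apply: cvgM; [exact: tilt_angle_cvg|exact: cvg_cst].
Qed.

Lemma sin_ratio_cvg k c c' : c' != 0 ->
  (sin (tilt_angle n k * c) / sin (tilt_angle n k * c')) @[n --> \oo] --> c / c'.
Proof.
move=> c'0.
have p0 : pi / 2 != 0 :> R by rewrite gt_eqF// divr_gt0// pi_gt0.
have H : ((n%:R * sin (tilt_angle n k * c)) / (n%:R * sin (tilt_angle n k * c')))
    @[n --> \oo] --> (pi / 2 * c) / (pi / 2 * c').
  apply: cvgM; first exact: sin_tilt_angle_cvg.
  apply: cvgV; first by rewrite mulf_neq0.
  exact: sin_tilt_angle_cvg.
rewrite (_ : c / c' = (pi / 2 * c) / (pi / 2 * c')); last first.
  by rewrite -mulf_div divff// mul1r.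
apply: cvg_trans H; apply: near_eq_cvg; near=> n.
have n0 : 0 < n%:R :> R by rewrite ltr0n; near: n; exact: nbhs_infty_gt.
by rewrite -mulf_div divff ?gt_eqF// mul1r.
Unshelve. all: by end_near. Qed.

(** cos a - cos th is twice the product of the sines of (th + a) / 2 ~ pi / (2n) and (th - a) / 2 ~
    pi k / (8 n^2), so the ratio is 1 - pi^2 k / (8 n^3) to first order. *)
Lemma cos_ratio_cvg k (c : R) (r : nat -> nat) :
  ((r n)%:R / n%:R ^+ 3) @[n --> \oo] --> c ->
  ((cos (tilt_angle n k) / cos (angle R n)) ^+ r n) @[n --> \oo] -->
    expR (- (c * (pi ^+ 2 * k / 8))).
Proof.
move=> rc.
pose D n : R := n%:R ^+ 3 * (cos (angle R n) - cos (tilt_angle n k)) / cos (angle R n).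
have t0 j : tilt_angle n j @[n --> \oo] --> (0 : R).
  by have := tilt_angle_cvg0 j 1; under eq_cvg do rewrite mulr1.
have ca : cos (angle R n) @[n --> \oo] --> (1 : R).
  by rewrite angleE; apply: cos_cvg1; exact: t0.
have DK : D n @[n --> \oo] --> pi ^+ 2 * k / 8.
  rewrite -[X in _ --> X]divr1; apply: cvgM; last first.
    by apply: cvgV ca; exact: oner_neq0.
  have S : (n%:R * sin ((tilt_angle n k + angle R n) / 2)) @[n --> \oo] --> pi / 2.
    apply: mul_sin_cvg.
      rewrite angleE; under eq_cvg do rewrite mulrA mulrDr.
      rewrite (_ : pi / 2 = (pi / 2 + pi / 2) / 2); last by field.
      by apply: cvgM; [apply: cvgD; exact: tilt_angle_cvg|exact: cvg_cst].
    rewrite angleE.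
    rewrite -[X in _ --> X](mul0r 2^-1); apply: cvgM; last exact: cvg_cst.
    by rewrite -[X in _ --> X]addr0; apply: cvgD; exact: t0.
  have T : (n%:R ^+ 2 * sin ((tilt_angle n k - angle R n) / 2)) @[n --> \oo]
      --> pi * k / 8.
    apply: mul_sin_cvg; last first.
      rewrite angleE.
      rewrite -[X in _ --> X](mul0r 2^-1); apply: cvgM; last exact: cvg_cst.
      by rewrite -[X in _ --> X]subr0; apply: cvgB; exact: t0.
    (* Exactly, th - a = th k / (2n). *)
    have H : ((n%:R * tilt_angle n k) * (k / 4)) @[n --> \oo] --> pi * k / 8.
      rewrite (_ : pi * k / 8 = pi / 2 * (k / 4)); last by field.
      by apply: cvgM; [exact: tilt_angle_cvg|exact: cvg_cst].
    apply: cvg_trans H; apply: near_eq_cvg; near=> n.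
    have n0 : n%:R != 0 :> R.
      by rewrite pnatr_eq0 -lt0n; near: n; exact: nbhs_infty_gt.
    have nk : k < 2 * n%:R.
      rewrite mulrC -ltr_pdivrMr//; near: n; exact: nbhs_infty_gtr.
    rewrite /angle /tilt_angle -mul2n natrM; field.
    by rewrite n0 subr_eq0 gt_eqF.
  have H : (n%:R * sin ((tilt_angle n k + angle R n) / 2) *
      (n%:R ^+ 2 * sin ((tilt_angle n k - angle R n) / 2)) * 2) @[n --> \oo]
      --> pi ^+ 2 * k / 8.
    rewrite (_ : pi ^+ 2 * k / 8 = pi / 2 * (pi * k / 8) * 2); last by field.
    by apply: cvgM; [apply: cvgM|exact: cvg_cst].
  apply: cvg_trans H; apply: near_eq_cvg; near=> n.
  set u := tilt_angle n k; set v := angle R n.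
  have -> : cos v = cos ((u + v) / 2 - (u - v) / 2) by congr cos; field.
  have -> : cos u = cos ((u + v) / 2 + (u - v) / 2) by congr cos; field.
  by rewrite cosB cosD; ring.
have nD n : (0 < n)%N -> cos (angle R n) != 0 ->
    cos (tilt_angle n k) / cos (angle R n) = 1 - D n / n%:R ^+ 3.
  move=> n0 c0; have nR : n%:R != 0 :> R by rewrite pnatr_eq0 -lt0n.
  by rewrite /D; field; rewrite nR c0.
have rD : ((r n)%:R * (D n / n%:R ^+ 3)) @[n --> \oo] --> c * (pi ^+ 2 * k / 8).
  by under eq_cvg do rewrite mulrCA mulrC; apply: cvgM.
have D0 : (D n / n%:R ^+ 3) @[n --> \oo] --> (0 : R).
  rewrite -[X in _ --> X](mulr0 (pi ^+ 2 * k / 8)); apply: cvgM => //.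
  rewrite (_ : (fun n => (n%:R ^+ 3)^-1) = fun n => (n%:R^-1) ^+ 3 :> R).
    rewrite -[X in _ --> X](mulr0 0); apply: cvgM; first exact: invn_cvg0.
    by rewrite -[X in _ --> X](mulr0 0); apply: cvgM; exact: invn_cvg0.
  by apply/funext => n; rewrite exprVn.
have H := expr_cvg_expR D0 rD.
apply: cvg_trans H; apply: near_eq_cvg; near=> n.
rewrite nD//; first by near: n; exact: nbhs_infty_gt.
rewrite gt_eqF// ; apply: cos_angle_gt0; near: n; exact: nbhs_infty_gt.
Unshelve. all: by end_near. Qed.

End Limits.

(** * Time scales and the limit of the site weight *)

Section Asymptotics.
Variable R : realType.

Lemma cvg0_sqr (f g : nat -> R) : (\forall n \near \oo, f n ^+ 2 <= g n) ->
  g n @[n --> \oo] --> (0 : R) -> f n @[n --> \oo] --> (0 : R).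
Proof.
move=> fg g0; apply/cvgrPdist_lt => e e0; near=> n.
rewrite sub0r normrN -(@ltr_pXn2r _ 2) ?nnegrE ?(ltW e0)//.
rewrite -normrX ger0_norm ?sqr_ge0//.
apply: le_lt_trans (_ : g n < _); first by near: n.
by near: n; apply: (cvgr_lt 0) => //; rewrite exprn_gt0.
Unshelve. all: by end_near. Qed.

Definition isqrt (n : nat) : nat := Num.truncn (Num.sqrt (n%:R : R)).

Lemma isqrtP n : (isqrt n)%:R ^+ 2 <= n%:R :> R /\ n%:R <= (isqrt n).+1%:R ^+ 2 :> R.
Proof.
have /andP[l u] := truncn_itv (sqrtr_ge0 (n%:R : R)).
have sE : Num.sqrt n%:R ^+ 2 = n%:R :> R by rewrite sqr_sqrtr.
have s0 := sqrtr_ge0 (n%:R : R).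
split.
  by rewrite -[leRHS]sE; apply: lerXn2r; rewrite ?nnegrE ?ler0n.
by rewrite -[leLHS]sE; apply: lerXn2r; rewrite ?nnegrE ?ler0n// ltW.
Qed.

Lemma isqrt_cvg0 : ((isqrt n)%:R / n%:R : R) @[n --> \oo] --> (0 : R).
Proof.
apply: (cvg0_sqr _ (@invn_cvg0 R)); near=> n.
have n0 : 0 < n%:R :> R by rewrite ltr0n; near: n; exact: nbhs_infty_gt.
rewrite expr_div_n ler_pdivrMr ?exprn_gt0// expr2 mulKf ?gt_eqF//.
by case: (isqrtP n).
Unshelve. all: by end_near. Qed.

Lemma isqrtS_cvg0 : ((isqrt n).+1%:R^-1 : R) @[n --> \oo] --> (0 : R).
Proof.
apply: (cvg0_sqr _ (@invn_cvg0 R)); near=> n.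
have n0 : 0 < n%:R :> R by rewrite ltr0n; near: n; exact: nbhs_infty_gt.
by rewrite exprVn lef_pV2 ?posrE// ?exprn_gt0//; case: (isqrtP n).
Unshelve. all: by end_near. Qed.

(* A time of order n^(5/2), between the mixing time n^2 and the horizon n^3. *)
Definition lag (n : nat) : nat := (n ^ 2 * isqrt n)%N.

Lemma lag_cvg0 : ((lag n)%:R / n%:R ^+ 3 : R) @[n --> \oo] --> (0 : R).
Proof.
apply: cvg_trans isqrt_cvg0; apply: near_eq_cvg; near=> n.
have n0 : n%:R != 0 :> R.
  by rewrite pnatr_eq0 -lt0n; near: n; exact: nbhs_infty_gt.
by rewrite /lag natrM natrX; field.
Unshelve. all: by end_near. Qed.

(** lam^2 = 1 - sin^2 a with n sin a >= 1/2 gives lam <= exp (- 1 / (8 n^2)), hence lam^lag <= exp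
    (- m / 8) with m = [isqrt n], while n^2 <= (m + 1)^4. *)
Lemma cos_angle_expr_cvg0 (r : nat -> nat) :
  (\forall n \near \oo, (lag n <= r n)%N) ->
  (n%:R ^+ 2 * cos (angle R n) ^+ r n) @[n --> \oo] --> (0 : R).
Proof.
(* A fifth power is enough to beat (m + 1)^4: exp (- m / 8) is the fifth power of exp (- m / 40),
   and exp (m / 40) >= (m + 1) / 40. *)
move=> lr; pose C : R := 40 ^+ 5.
have H : (C * (isqrt n).+1%:R^-1) @[n --> \oo] --> (0 : R).
  rewrite -[X in _ --> X](mulr0 C); apply: cvgM; first exact: cvg_cst.
  exact: isqrtS_cvg0.
apply: (cvg0_le _ H); near=> n.
have n2 : (1 < n)%N by near: n; exact: nbhs_infty_gt.
have nR : 0 < n%:R :> R by rewrite ltr0n ltnW.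
have l0 := cos_angle_gt0 R n2.
set lam := cos _ in l0 *; set m := isqrt n.
rewrite ger0_norm; last by rewrite mulr_ge0 ?exprn_ge0 ?ltW.
apply: (@le_trans _ _ (m.+1%:R ^+ 4 * lam ^+ lag n)).
  apply: ler_pM; rewrite ?exprn_ge0 ?(ltW l0) ?(ltW nR)//.
    rewrite (_ : m.+1%:R ^+ 4 = (m.+1%:R ^+ 2) ^+ 2); last by rewrite -exprM.
    rewrite lerXn2r ?nnegrE ?exprn_ge0 ?(ltW nR)//.
    by case: (isqrtP n).
  by rewrite ler_wiXn2l ?(ltW l0) ?cos_le1//; near: n.
have sn : 1 / 2 <= n%:R * sin (angle R n).
  rewrite angleE -[tilt_angle _ _]mulr1; near: n.
  apply: (cvgr_ge (pi / 2 * 1)); first exact: sin_tilt_angle_cvg.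
  by have := pihalf_ge1 R; lra.
have l1 : lam <= expR (- (8 * n%:R ^+ 2)^-1).
  rewrite -(@ler_pXn2r _ 2) ?nnegrE ?expR_ge0 ?(ltW l0)//.
  rewrite -expRM_natr (_ : - _ * 2 = - (4 * n%:R ^+ 2)^-1); last first.
    by field; rewrite gt_eqF.
  apply: le_trans (expR_ge1Dx _); rewrite /lam cos2sin2 lerD2l lerN2.
  rewrite -div1r ler_pdivrMr ?mulr_gt0 ?exprn_gt0//.
  have -> : sin (angle R n) ^+ 2 * (4 * n%:R ^+ 2) = (2 * (n%:R * sin (angle R n))) ^+ 2.
    by ring.
  by rewrite -[leLHS](expr1n _ 2) lerXn2r ?nnegrE//; lra.
have l2 : lam ^+ lag n <= (40 / m.+1%:R) ^+ 5.
  apply: (@le_trans _ _ (expR (- (8 * n%:R ^+ 2)^-1) ^+ lag n)).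
    by rewrite lerXn2r ?nnegrE ?expR_ge0 ?(ltW l0).
  rewrite -expRM_natr /lag natrM natrX.
  rewrite (_ : _ * _ = - (m%:R / 40) * 5%:R); last by field; rewrite gt_eqF.
  rewrite expRM_natr lerXn2r ?nnegrE ?expR_ge0 ?divr_ge0//.
  rewrite expRN -[leRHS]invf_div lef_pV2 ?posrE ?expR_gt0 ?divr_gt0//.
  apply: le_trans (expR_ge1Dx _); rewrite -natr1 mulrDl; lra.
apply: (@le_trans _ _ (m.+1%:R ^+ 4 * (40 / m.+1%:R) ^+ 5)).
  by rewrite ler_wpM2l.
rewrite expr_div_n -/C le_eqVlt; apply/orP; left; apply/eqP.
by field; rewrite addrC natr1 pnatr_eq0.
Unshelve. all: by end_near. Qed.

Section Horizon.
Variable alpha : R.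
Hypothesis alpha0 : 0 < alpha.

Lemma ring_time_cvg :
  ((ring_time alpha n)%:R / n%:R ^+ 3 : R) @[n --> \oo] --> 4 * alpha / pi ^+ 2.
Proof.
apply: (@cvg_of_sub R _ (fun=> 4 * alpha / pi ^+ 2) (4 * alpha / pi ^+ 2)); last exact: cvg_cst.
apply: (cvg0_le _ (@invn_cvg0 R)); near=> n.
have n0 : 1 <= n%:R :> R by rewrite ler1n; near: n; exact: nbhs_infty_gt.
have p0 := pi_gt0 R.
have nR : 0 < n%:R :> R by apply: lt_le_trans n0.
have n3 : 0 < n%:R ^+ 3 :> R by rewrite exprn_gt0.
have T0 : 0 <= 4 * alpha * n%:R ^+ 3 / pi ^+ 2.
  by rewrite divr_ge0 ?mulr_ge0 ?exprn_ge0 ?(ltW p0) ?(ltW nR) ?(ltW alpha0).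
have /andP[l u] := truncn_itv T0.
rewrite /ring_time; set t := Num.truncn _ in l u *.
have -> : t%:R / n%:R ^+ 3 - 4 * alpha / pi ^+ 2 =
    (t%:R - 4 * alpha * n%:R ^+ 3 / pi ^+ 2) / n%:R ^+ 3.
  rewrite mulrBl; congr (_ - _); rewrite [RHS]mulrAC mulfK//.
  by rewrite (gt_eqF n3).
rewrite normrM normfV (gtr0_norm n3) ler_pdivrMr//.
apply: (@le_trans _ _ 1).
  by rewrite ler_norml; move: u; rewrite -natr1 => u; apply/andP; split; lra.
by rewrite exprS mulKf ?gt_eqF// exprn_ege1.
Unshelve. all: by end_near. Qed.

(** Twice the lag, so that the time left before the last stretch is itself long enough to mix. *)
Lemma lag_le_ring_time :
  \forall n \near \oo, (lag n + lag n <= ring_time alpha n)%N.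
Proof.
have p0 := pi_gt0 R.
pose f n : R := (ring_time alpha n)%:R / n%:R ^+ 3 - (lag n)%:R / n%:R ^+ 3
  - (lag n)%:R / n%:R ^+ 3.
have H : f n @[n --> \oo] --> 4 * alpha / pi ^+ 2.
  rewrite -[X in _ --> X]subr0 -[X in _ --> X]subr0.
  apply: cvgB lag_cvg0; apply: cvgB lag_cvg0; exact: ring_time_cvg.
near=> n.
have n3 : 0 < n%:R ^+ 3 :> R.
  by rewrite exprn_gt0// ltr0n; near: n; exact: nbhs_infty_gt.
have : 0 <= f n.
  near: n; apply: (cvgr_ge _ H).
  by rewrite divr_gt0 ?mulr_gt0 ?exprn_gt0.
rewrite /f -!mulrBl pmulr_lge0 ?invr_gt0// -(ler_nat R) natrD; lra.
Unshelve. all: by end_near. Qed.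

Definition early (n : nat) : nat := (ring_time alpha n - lag n)%N.

Lemma early_cvg : ((early n)%:R / n%:R ^+ 3 : R) @[n --> \oo] --> 4 * alpha / pi ^+ 2.
Proof.
have H : ((ring_time alpha n)%:R / n%:R ^+ 3 - (lag n)%:R / n%:R ^+ 3 : R)
    @[n --> \oo] --> 4 * alpha / pi ^+ 2.
  by rewrite -[X in _ --> X]subr0; apply: cvgB lag_cvg0; exact: ring_time_cvg.
apply: cvg_trans H; apply: near_eq_cvg; near=> n.
rewrite -mulrBl -natrB//.
have : (lag n + lag n <= ring_time alpha n)%N by near: n; exact: lag_le_ring_time.
lia.
Unshelve. all: by end_near. Qed.

Lemma lag_le_early : \forall n \near \oo, (lag n <= early n)%N.
Proof. by apply: filterS lag_le_ring_time => n; rewrite /early; lia. Qed.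

End Horizon.

Section TiltLimit.
Variables (kappa : R) (x : nat).
Hypotheses (x0 : (0 < x)%N) (kappa0 : 0 < kappa) (kappax : kappa < x%:R).

(** As n grows the sines become linear: [tilt] is proportional to (x - kappa) y / x up to x and to y
    - kappa beyond. The formula for [tilt_weight] with these values gives this fraction. *)
Definition tilt_weight_lim : R :=
  2 * x%:R * (x%:R - kappa) / (2 * x%:R * (x%:R - kappa) + kappa).

Let xR : 0 < x%:R :> R. Proof. by rewrite ltr0n. Qed.

Let den0 : 0 < 2 * x%:R * (x%:R - kappa) + kappa.
Proof. by rewrite addr_gt0// !mulr_gt0// subr_gt0. Qed.

Lemma tilt_weight_lim_itv : 0 < tilt_weight_lim < 1.
Proof.
rewrite /tilt_weight_lim divr_gt0//=; last by rewrite !mulr_gt0// subr_gt0.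
by rewrite ltr_pdivrMr// mul1r ltrDl.
Qed.

Lemma tilt_weight_cvg : tilt_weight n x kappa @[n --> \oo] --> tilt_weight_lim.
Proof.
have p0 := pi_gt0 R.
pose q : R := (x%:R - kappa) / x%:R.
have Hle y : (y <= x)%N -> (n%:R * tilt n x kappa y) @[n --> \oo] --> q * (pi / 2 * y%:R).
  move=> yx; rewrite /tilt yx; under eq_cvg do rewrite mulrCA.
  apply: cvgM; last exact: sin_tilt_angle_cvg.
  by apply: sin_ratio_cvg; rewrite gt_eqF.
have Hgt : (n%:R * tilt n x kappa x.+1) @[n --> \oo] --> pi / 2 * (x.+1%:R - kappa).
  by rewrite /tilt ltnn; exact: sin_tilt_angle_cvg.
have zE : tilt_weight_lim = 1 * (q * (pi / 2 * x%:R)) /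
    ((q * (pi / 2 * x.-1%:R) + pi / 2 * (x.+1%:R - kappa)) / 2).
  have -> : x.-1%:R = x%:R - 1 :> R by rewrite -subn1 natrB.
  have : 0 < pi / 2 :> R by rewrite divr_gt0.
  move: (pi / 2 : R) => h h0; rewrite /tilt_weight_lim /q -natr1; field.
  rewrite (gt_eqF xR) (gt_eqF den0) andbT/=.
  rewrite (_ : _ + _ * x%:R = h * (2 * x%:R * (x%:R - kappa) + kappa)); last by ring.
  by rewrite mulf_neq0 // gt_eqF.
have D0 : (q * (pi / 2 * x.-1%:R) + pi / 2 * (x.+1%:R - kappa)) / 2 != 0.
  have q0 : 0 < q by rewrite divr_gt0 ?subr_gt0.
  rewrite gt_eqF// divr_gt0//; apply: ltr_wpDl.
    by rewrite mulr_ge0 ?(ltW q0)// mulr_ge0// divr_ge0// ltW.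
  by rewrite mulr_gt0 ?divr_gt0// subr_gt0 (lt_trans kappax)// ltr_nat.
have H : (cos (tilt_angle n kappa) * (n%:R * tilt n x kappa x) /
    ((n%:R * tilt n x kappa x.-1 + n%:R * tilt n x kappa x.+1) / 2))
    @[n --> \oo] --> tilt_weight_lim.
  rewrite zE; apply: cvgM; last first.
    apply: cvgV; first exact: D0.
    apply: cvgM; last exact: cvg_cst.
    by apply: cvgD; [apply: Hle; exact: leq_pred|exact: Hgt].
  apply: cvgM; last exact: Hle.
  by apply: cos_cvg1; have := @tilt_angle_cvg0 R kappa 1; under eq_cvg do rewrite mulr1.
apply: cvg_trans H; apply: near_eq_cvg; near=> n.
have n0 : n%:R != 0 :> R.
  by rewrite pnatr_eq0 -lt0n; near: n; exact: nbhs_infty_gt.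
rewrite /tilt_weight -mulrDr -mulrA -[_ * _ / 2]mulrA invfM.
by rewrite [n%:R * _]mulrC -[in LHS]mulrA [X in _ * (_ * X)]mulrA mulfV// mul1r mulrA.
Unshelve. all: by end_near. Qed.

(** Majorant for the distance in [tilt_sub_sine]. The first term serves beyond x, where the angles
    differ by at most th kappa because (th - a) 2n = th kappa; the rest serves up to x, where both
    functions are O(1/n). *)
Definition tilt_gap (n : nat) : R := tilt_angle n kappa * kappa +
  (`|sin (tilt_angle n kappa * (x%:R - kappa)) / sin (tilt_angle n kappa * x%:R)|
    * (tilt_angle n kappa * x%:R) * (1 + (tilt_weight n x kappa)^-1)
  + tilt_angle n 0 * x%:R).

Lemma tilt_gap_cvg0 : tilt_gap n @[n --> \oo] --> (0 : R).
Proof.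
rewrite -[X in _ --> X]addr0; apply: cvgD; first exact: tilt_angle_cvg0.
rewrite -[X in _ --> X]addr0; apply: cvgD; last exact: tilt_angle_cvg0.
have [z0 _] := andP tilt_weight_lim_itv.
rewrite -[X in _ --> X](mul0r (1 + tilt_weight_lim^-1)); apply: cvgM; last first.
  apply: cvgD; first exact: cvg_cst.
  by apply: cvgV; [rewrite gt_eqF|exact: tilt_weight_cvg].
rewrite -[X in _ --> X](mulr0 `|(x%:R - kappa) / x%:R|); apply: cvgM.
  by apply: cvg_norm; apply: sin_ratio_cvg; rewrite gt_eqF.
exact: tilt_angle_cvg0.
Qed.

Lemma tilt_sub_sine n y : (1 < n)%N -> (x < n)%N -> 0 < tilt_weight n x kappa ->
  (y <= n.*2)%N ->
  `|tilt n x kappa y / site_weight x (tilt_weight n x kappa) y - sine R n y|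
  <= tilt_gap n.
Proof.
move=> n2 xn z0 yn; have p0 := pi_gt0 R.
have nk : 0 < n.*2%:R - kappa.
  by rewrite subr_gt0 (lt_trans kappax)// ltr_nat; lia.
have th0 : 0 < tilt_angle n kappa by rewrite divr_gt0.
have a0 : 0 < tilt_angle n 0 :> R by have := angle_gt0 R (ltnW n2); rewrite angleE.
have zi : 0 < (tilt_weight n x kappa)^-1 by rewrite invr_gt0.
rewrite /sine angleE/= /tilt_gap.
set th := tilt_angle n kappa in th0 *; set a := tilt_angle n 0 in a0 *.
set A := `|_ / _|; set z := tilt_weight n x kappa in z0 zi *.
have A0 : 0 <= A := normr_ge0 _.
rewrite /tilt /site_weight; have [yx|xy] := leqP y x.
  have yx' : y%:R <= x%:R :> R by rewrite ler_nat.
  rewrite (le_trans (ler_normB _ _))// -[leLHS]add0r; apply: lerD.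
    by rewrite mulr_ge0// ltW.
  apply: lerD; last first.
    by apply: (le_trans (sin_le_norm _)); rewrite ger0_norm ?ler_pM2l// mulr_ge0// ltW.
  rewrite normrM normrM -/th -/A; apply: ler_pM; rewrite ?mulr_ge0//.
    apply: ler_wpM2l; first exact: A0.
    by apply: (le_trans (sin_le_norm _)); rewrite ger0_norm ?ler_pM2l// mulr_ge0// ltW.
  case: eqP => _; rewrite ?invr1 ?normr1 ?(gtr0_norm zi); lra.
rewrite ifF; last by rewrite gtn_eqF.
rewrite divr1 (le_trans (sin_lipschitz _ _))// -[leLHS]addr0; apply: lerD; last first.
  apply: addr_ge0; last by rewrite mulr_ge0// ltW.
  apply: mulr_ge0; last by rewrite addr_ge0// ltW.
  by rewrite mulr_ge0// mulr_ge0// ltW.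
have E : (th - a) * n.*2%:R = th * kappa.
  have e1 : a * n.*2%:R = pi by rewrite /a /tilt_angle subr0 divfK// pnatr_eq0; lia.
  have : th * (n.*2%:R - kappa) = pi by rewrite /th divfK// gt_eqF.
  by rewrite mulrBl e1; lra.
have d0 : 0 <= th - a.
  have : 0 <= (th - a) * n.*2%:R by rewrite E mulr_ge0// ltW.
  by rewrite pmulr_lge0// ltr0n; lia.
have : (th - a) * y%:R <= (th - a) * n.*2%:R by rewrite ler_wpM2l// ler_nat.
rewrite E => h1; have h2 : 0 <= (th - a) * y%:R by rewrite mulr_ge0.
have h3 : 0 <= th * kappa by rewrite mulr_ge0// ltW.
by rewrite (_ : th * (y%:R - kappa) - a * y%:R = (th - a) * y%:R - th * kappa); [rewrite ler_norml; apply/andP; split; lra|ring].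
Qed.

End TiltLimit.
End Asymptotics.

(** * Asymptotics of the generating function *)

Section Survival.
Variable R : realType.
Implicit Types (n : nat) (r : nat -> nat).

Local Notation lam n := (cos (angle R n)).
Local Notation one n := (inside R n).

(** The error of [iter_avg_inside] relative to [lam n ^+ s]: the alternating mode, then the middle
    modes. *)
Definition mix_err (n s : nat) : R := 2 / n%:R + n.*2%:R * 2 * lam n ^+ s.

Lemma mix_err_cvg0 r : (\forall n \near \oo, (lag R n <= r n)%N) ->
  mix_err n (r n) @[n --> \oo] --> (0 : R).
Proof.
move=> lr; have H : (2 * n%:R^-1 + 4 * (n%:R ^+ 2 * lam n ^+ r n)) @[n --> \oo] --> (0 : R).
  rewrite -[X in _ --> X]addr0 -[X in _ --> X + _](mulr0 2).
  rewrite -[X in _ --> _ + X](mulr0 4); apply: cvgD.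
    by apply: cvgM; [exact: cvg_cst|exact: invn_cvg0].
  by apply: cvgM; [exact: cvg_cst|exact: cos_angle_expr_cvg0].
apply: (cvg0_le _ H); near=> n.
have n2 : (1 < n)%N by near: n; exact: nbhs_infty_gt.
have l0 : 0 <= lam n by rewrite ltW// cos_angle_gt0.
have L0 : 0 <= lam n ^+ r n by rewrite exprn_ge0.
rewrite /mix_err ger0_norm; last by rewrite addr_ge0 ?divr_ge0 ?mulr_ge0.
rewrite lerD2l -mul2n natrM.
rewrite [leLHS](_ : _ = 4 * (n%:R * lam n ^+ r n)); last by ring.
rewrite ler_pM2l// ler_wpM2r// expr2 ler_peMl ?ler0n// ler1n.
exact: ltnW.
Unshelve. all: by end_near. Qed.

Lemma survival_le n s : (1 < n)%N ->
  iter s (avg n) (one n) n <= lam n ^+ s * (2 + mix_err n s).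
Proof.
move=> n2; have nn : (n <= n.*2)%N by lia.
have := iter_avg_inside R n2 s nn.
rewrite angle_pihalf ?(ltnW n2)// sin_pihalf mulr1 => /(le_trans (ler_norm _)).
have L0 : 0 <= lam n ^+ s by rewrite exprn_ge0// ltW// cos_angle_gt0.
have : sine_coef n (one n) 1 * lam n ^+ s <= 2 * lam n ^+ s.
  by rewrite ler_wpM2r// (le_trans (ler_norm _))// sine_coef_inside_le// ltnW.
rewrite -/(mix_err n s); lra.
Qed.

(** The principal sine lies below the indicator of the interior and equals 1 at the starting
    site. *)
Lemma survival_ge n s : (1 < n)%N -> lam n ^+ s <= iter s (avg n) (one n) n.
Proof.
move=> n2; have nn : (n <= n.*2)%N by lia.
have := iter_avg_sine R n2 s nn.
rewrite {2}/sine angle_pihalf ?(ltnW n2)// sin_pihalf mulr1 => <-.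
rewrite -wavg1; apply: iter_wavg_le => // y yn.
rewrite /inside; case: (boolP (inner n y)) => [_|].
  by rewrite /sine sin_le1.
rewrite /inner negb_and -leqNgt leqn0 -leqNgt => /orP[/eqP ->|ny].
  by rewrite sine0.
have -> : y = n.*2 by apply/eqP; rewrite eqn_leq yn.
by rewrite sine_end.
Qed.

End Survival.

Section Ratio.
Variables (R : realType) (alpha kappa : R) (x : nat).
Hypotheses (alpha0 : 0 < alpha) (x0 : (0 < x)%N).
Hypotheses (kappa0 : 0 < kappa) (kappax : kappa < x%:R).
Implicit Types (n : nat) (r : nat -> nat).

Local Notation lam n := (cos (angle R n)).
Local Notation z n := (tilt_weight n x kappa).
Local Notation W n := (wavg n (site_weight x (z n))).
Local Notation one n := (inside R n).

Local Notation mix_err := (mix_err R).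

Lemma tilt_weight_near : \forall n \near \oo, 0 < z n < 1.
Proof.
have zc := @tilt_weight_cvg R kappa x x0 kappa0 kappax.
have /andP[l0 l1] := @tilt_weight_lim_itv R kappa x x0 kappa0 kappax.
near=> n; apply/andP; split; near: n.
  exact: (cvgr_gt (tilt_weight_lim kappa x)).
exact: (cvgr_lt (tilt_weight_lim kappa x)).
Unshelve. all: by end_near. Qed.

(** The sine is exchanged for the exact eigenfunction [psi], which costs [tilt_gap] twice: under the
    iteration, times the survival bound, and in the value at the starting site. *)
Lemma tilted_sine_approx n s : (1 < n)%N -> (x < n)%N -> 0 < z n < 1 ->
  `|iter s (W n) (sine R n) n / lam n ^+ s
    - (cos (tilt_angle n kappa) / lam n) ^+ s| <=
  tilt_gap kappa x n * (2 + mix_err n s) +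
  `|cos (tilt_angle n kappa) / lam n| ^+ s * tilt_gap kappa x n.
Proof.
move=> n2 xn /andP[z0 z1]; have nn : (n <= n.*2)%N by lia.
have l0 := cos_angle_gt0 R n2.
have L0 : 0 < lam n ^+ s by rewrite exprn_gt0.
have p0 := pi_gt0 R.
set th := tilt_angle n kappa; set g := tilt_gap kappa x n.
pose psi y : R := tilt n x kappa y / site_weight x (z n) y.
have kn : kappa < n.*2%:R by rewrite (lt_trans kappax)// ltr_nat; lia.
have gap y : (y <= n.*2)%N -> `|psi y - sine R n y| <= g.
  by move=> yn; apply: tilt_sub_sine.
have sx : sin (th * x%:R) != 0.
  rewrite gt_eqF// sin_gt0_pi// mulr_gt0 ?ltr0n ?divr_gt0 ?subr_gt0//=.
  rewrite /th /tilt_angle mulrAC ltr_pdivrMr ?subr_gt0// ltr_pM2l//.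
  rewrite ltrBrDr; apply: (@lt_le_trans _ _ (x%:R + x%:R)); first by rewrite ltrD2l.
  by rewrite -natrD ler_nat; lia.
have eig := @iter_wavg_eigen R n _ _ psi s n
  (@wavg_tilt R n x kappa x0 xn kn sx (lt0r_neq0 z0)) nn.
have w01 y : 0 <= site_weight x (z n) y <= 1.
  by rewrite /site_weight; case: eqP => _; rewrite ?ler01 ?lexx ?(ltW z0) ?(ltW z1).
have psi0 : psi 0 = 0 by rewrite /psi /tilt leq0n mulr0 sin0 mulr0 mul0r.
have psin : psi n.*2 = 0.
  rewrite /psi /tilt leqNgt (_ : x < n.*2)%N/=; last by lia.
  by rewrite /tilt_angle divfK ?sinpi ?mul0r// gt_eqF// subr_gt0.
have g0 : 0 <= g by apply: le_trans (gap n nn).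
have D : `|iter s (W n) (sine R n) n - cos th ^+ s * psi n| <=
    g * (lam n ^+ s * (2 + mix_err n s)).
  rewrite -eig; have := iter_wavg_lin n (site_weight x (z n)) s (-1) psi (sine R n).
  move=> /(congr1 (fun h => h n)); rewrite mulN1r addrC => <-.
  apply: (@le_trans _ _ (g * iter s (avg n) (one n) n)).
    apply: iter_wavg_sup => //.
    - by rewrite psi0 sine0 mulr0 addr0.
    - by rewrite psin (sine_end R n2) mulr0 addr0.
    - by move=> y yn; rewrite mulN1r addrC distrC gap.
  by rewrite ler_wpM2l// survival_le.
have P1 : `|psi n - 1| <= g.
  by have := gap n nn; rewrite {1}/sine angle_pihalf ?(ltnW n2)// sin_pihalf.
rewrite expr_div_n -[X in `|X|](subrKA (cos th ^+ s * psi n / lam n ^+ s)).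
rewrite (le_trans (ler_normD _ _))//; apply: lerD.
  rewrite -mulrBl normrM normfV (gtr0_norm L0) ler_pdivrMr//.
  by rewrite -[leRHS]mulrA [_ * lam n ^+ s]mulrC.
rewrite mulrAC -[X in _ - X]mulr1 -mulrBr normrM -normrX expr_div_n.
by rewrite ler_wpM2l.
Qed.

Lemma tilted_sine_cvg r (c : R) : (\forall n \near \oo, (lag R n <= r n)%N) ->
  ((r n)%:R / n%:R ^+ 3 : R) @[n --> \oo] --> c ->
  (iter (r n) (W n) (sine R n) n / lam n ^+ r n) @[n --> \oo] -->
    expR (- (c * (pi ^+ 2 * kappa / 8))).
Proof.
move=> lr rc; have rho := @cos_ratio_cvg R kappa c r rc.
apply: (cvg_of_sub _ rho).
have gap0 := @tilt_gap_cvg0 R kappa x x0 kappa0 kappax.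
have H : (tilt_gap kappa x n * (2 + mix_err n (r n)) +
    `|(cos (tilt_angle n kappa) / lam n) ^+ r n| * tilt_gap kappa x n)
    @[n --> \oo] --> (0 : R).
  rewrite -[X in _ --> X]addr0 -[X in _ --> X + _](mul0r (2 + 0)).
  rewrite -[X in _ --> _ + X](mulr0 `|expR (- (c * (pi ^+ 2 * kappa / 8)))|).
  apply: cvgD.
    apply: cvgM; first exact: gap0.
    by apply: cvgD; [exact: cvg_cst|exact: mix_err_cvg0].
  by apply: cvgM; [exact: cvg_norm|exact: gap0].
apply: (cvg0_le _ H); near=> n.
rewrite normrX; apply: tilted_sine_approx; near: n.
- exact: nbhs_infty_gt.
- exact: nbhs_infty_gt.
- exact: tilt_weight_near.
Unshelve. all: by end_near. Qed.

Let t n := ring_time alpha n.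

Lemma ring_time_split : \forall n \near \oo, t n = (early alpha n + lag R n)%N.
Proof.
apply: filterS (@lag_le_ring_time R alpha alpha0) => n; rewrite /early /t; lia.
Qed.

(** With everything divided by [lam n ^+ t n], the weighted survival is close to [c n * B n] and the
    unweighted one to [c n], while [B n] tends to [E]. The limit of [c n] is never computed: [c n]
    is at most 2 in modulus and the denominator [V n] is at least 1. *)
Lemma survival_ratio_cvg :
  (iter (t n) (W n) (one n) n / iter (t n) (avg n) (one n) n) @[n --> \oo] -->
    expR (- (alpha * kappa / 2)).
Proof.
set E := expR _.
have p0 := pi_gt0 R.
have cE (c : R) : c = 4 * alpha / pi ^+ 2 -> expR (- (c * (pi ^+ 2 * kappa / 8))) = E.
  have gen (p : R) : p != 0 -> 4 * alpha / p * (p * kappa / 8) = alpha * kappa / 2.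
    by move=> h; field.
  by move=> ->; rewrite /E gen// gt_eqF// exprn_gt0.
pose B n : R := iter (early alpha n) (W n) (sine R n) n / lam n ^+ early alpha n.
pose C n : R := iter (t n) (W n) (sine R n) n / lam n ^+ t n.
pose c n : R := sine_coef n (one n) 1.
pose F n : R := iter (t n) (W n) (one n) n / lam n ^+ t n.
pose V n : R := iter (t n) (avg n) (one n) n / lam n ^+ t n.
have le_e := @lag_le_early R alpha alpha0.
have le_t : \forall n \near \oo, (lag R n <= t n)%N.
  by apply: filterS (@lag_le_ring_time R alpha alpha0) => n; rewrite /t; lia.
have BE : B n @[n --> \oo] --> E.
  by rewrite -(cE _ erefl); apply: tilted_sine_cvg => //; exact: early_cvg.
have CE : C n @[n --> \oo] --> E.
  by rewrite -(cE _ erefl); apply: tilted_sine_cvg => //; exact: ring_time_cvg.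
have lagr : \forall n \near \oo, (lag R n <= lag R n)%N by apply: nearW.
have split n K : (1 < n)%N -> (x < n)%N -> 0 < z n < 1 ->
    t n = (early alpha n + lag R n)%N -> 0 < K -> 1 / 2 <= n%:R * sin (angle R n) ->
    `|F n - c n * B n| <= mix_err n (lag R n) * (2 + mix_err n (early alpha n))
      + K / 2 * (B n - C n) + (2 * K)^-1 * (4 + 8 * (n%:R ^+ 2 * lam n ^+ t n)).
  move=> n2 xn /andP[z0 z1] tE K0 sn.
  have l0 := cos_angle_gt0 R n2.
  have L0 m : 0 < lam n ^+ m by rewrite exprn_gt0.
  have nR : 0 < n%:R :> R by rewrite ltr0n ltnW.
  have w01 y : 0 <= site_weight x (z n) y <= 1.
    by rewrite /site_weight; case: eqP => _; rewrite ?ler01 ?lexx ?(ltW z0) ?(ltW z1).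
  have := @iter_wavg_split R n n2 (site_weight x (z n)) (c n) K
    (lam n ^+ lag R n * mix_err n (lag R n)) (early alpha n) (lag R n) w01 K0
    (fun y yn => iter_avg_inside R n2 (lag R n) yn).
  rewrite -tE; set r := early alpha n in tE *; set s := lag R n in tE *.
  have LE : lam n ^+ t n = lam n ^+ r * lam n ^+ s by rewrite tE exprD.
  have -> : iter (t n) (W n) (one n) n - c n * lam n ^+ s * iter r (W n) (sine R n) n
      = lam n ^+ t n * (F n - c n * B n).
    by rewrite /F /B -/r LE; field; rewrite !gt_eqF.
  have -> : lam n ^+ s * iter r (W n) (sine R n) n - iter (t n) (W n) (sine R n) n
      = lam n ^+ t n * (B n - C n).
    by rewrite /C /B -/r LE; field; rewrite !gt_eqF.
  rewrite normrM (gtr0_norm (L0 _)) => H; rewrite -(ler_pM2l (L0 (t n))).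
  apply: (le_trans H); rewrite [leRHS]mulrDr [X in _ <= X + _]mulrDr.
  apply: lerD; [apply: lerD|].
  - have e0 : 0 <= mix_err n s.
      by rewrite /mix_err addr_ge0 ?divr_ge0 ?mulr_ge0 ?(ltW (L0 _)).
    have := survival_le R r n2; move=> H1.
    rewrite LE (_ : _ * _ * (_ * _) = lam n ^+ s * mix_err n s * (lam n ^+ r * (2 + mix_err n r))); last by ring.
    by rewrite ler_wpM2l// mulr_ge0// ltW.
  - by rewrite mulrCA.
  - rewrite [leRHS]mulrCA ler_pM2l ?invr_gt0 ?mulr_gt0//.
    apply: (le_trans (iter_avg_inv_sine R n2 _)); rewrite ler_pM2l// lerD2l.
    rewrite [leRHS]mulrA ler_pM2r// -mul2n natrM.
    have s0 := sin_angle_gt0 R n2.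
    rewrite mulrA ler_pdivrMr// (_ : 8 * n%:R ^+ 2 * sin _ = 8 * n%:R * (n%:R * sin (angle R n))); last by ring.
    have : 8 * n%:R * (1 / 2) <= 8 * n%:R * (n%:R * sin (angle R n)).
      by rewrite ler_pM2l// mulr_gt0.
    lra.
have e1 := mix_err_cvg0 lagr; have e2 := mix_err_cvg0 le_e.
have e3 := cos_angle_expr_cvg0 le_t.
have FB : (F n - c n * B n) @[n --> \oo] --> (0 : R).
  apply/cvgrPdist_le => e e0.
  (* For fixed [K] the loss [K / 2 * (B n - C n)] vanishes in the limit, leaving 4 / (2K) = 2e / 5 <
     e. *)
  pose K : R := 5 / e.
  have K0 : 0 < K by rewrite divr_gt0.
  have H : (mix_err n (lag R n) * (2 + mix_err n (early alpha n))
      + K / 2 * (B n - C n) + (2 * K)^-1 * (4 + 8 * (n%:R ^+ 2 * lam n ^+ t n)))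
      @[n --> \oo] --> 0 * (2 + 0) + K / 2 * (E - E) + (2 * K)^-1 * (4 + 8 * 0).
    apply: cvgD; last first.
      apply: cvgM; first exact: cvg_cst.
      apply: cvgD; first exact: cvg_cst.
      by apply: cvgM; [exact: cvg_cst|exact: e3].
    apply: cvgD.
      apply: cvgM; first exact: e1.
      by apply: cvgD; [exact: cvg_cst|exact: e2].
    by apply: cvgM; [exact: cvg_cst|exact: cvgB].
  have lte : 0 * (2 + 0) + K / 2 * (E - E) + (2 * K)^-1 * (4 + 8 * 0) < e.
    rewrite subrr !mulr0 mul0r !addr0 add0r /K.
    rewrite (_ : _ * _ = e * (2 / 5)); last by field; rewrite gt_eqF.
    by rewrite gtr_pMr//; lra.
  near=> n; rewrite sub0r normrN.
  have n2 : (1 < n)%N by near: n; exact: nbhs_infty_gt.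
  have xn : (x < n)%N by near: n; exact: nbhs_infty_gt.
  have z01 : 0 < z n < 1 by near: n; exact: tilt_weight_near.
  have tE : t n = (early alpha n + lag R n)%N by near: n; exact: ring_time_split.
  have sn : 1 / 2 <= n%:R * sin (angle R n).
    rewrite angleE -[tilt_angle _ _]mulr1; near: n.
    apply: (cvgr_ge (pi / 2 * 1)); first exact: sin_tilt_angle_cvg.
    by have := pihalf_ge1 R; lra.
  apply: (le_trans (split n K n2 xn z01 tE K0 sn)); near: n.
  exact: (cvgr_le _ H).
have Vc : (V n - c n) @[n --> \oo] --> (0 : R).
  apply: (cvg0_le _ (mix_err_cvg0 le_t)); near=> n.
  have n2 : (1 < n)%N by near: n; exact: nbhs_infty_gt.
  have nn : (n <= n.*2)%N by lia.
  have L0 : 0 < lam n ^+ t n by rewrite exprn_gt0// cos_angle_gt0.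
  have := iter_avg_inside R n2 (t n) nn.
  rewrite angle_pihalf ?(ltnW n2)// sin_pihalf mulr1 -/(c n) -/(mix_err n (t n)).
  rewrite (_ : _ - _ = lam n ^+ t n * (V n - c n)); last first.
    by rewrite /V; field; rewrite gt_eqF.
  by rewrite normrM (gtr0_norm L0) ler_pM2l.
(* These three terms add up to [F n - E * V n]. *)
have H : (F n - c n * B n + c n * (B n - E) - E * (V n - c n)) @[n --> \oo] --> (0 : R).
  rewrite -[X in _ --> X]subr0; apply: cvgB; last first.
    by rewrite -(mulr0 E); apply: cvgM; [exact: cvg_cst|exact: Vc].
  rewrite -[X in _ --> X]addr0; apply: cvgD; first exact: FB.
  have H2 : (2 * `|B n - E|) @[n --> \oo] --> (0 : R).
    rewrite -(mulr0 2); apply: cvgM; first exact: cvg_cst.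
    rewrite -(normr0 R); apply: cvg_norm; rewrite -(subrr E).
    by apply: cvgB => //; exact: cvg_cst.
  apply: (cvg0_le _ H2); near=> n; rewrite normrM ler_wpM2r//.
  by apply: sine_coef_inside_le; near: n; exact: nbhs_infty_gt.
apply: (@cvg_of_sub R _ (fun=> E)); last exact: cvg_cst.
have H3 : `|F n - c n * B n + c n * (B n - E) - E * (V n - c n)| @[n --> \oo] --> (0 : R).
  by rewrite -(normr0 R); exact: cvg_norm.
apply: (cvg0_le _ H3); near=> n.
have n2 : (1 < n)%N by near: n; exact: nbhs_infty_gt.
have L0 : 0 < lam n ^+ t n by rewrite exprn_gt0// cos_angle_gt0.
have V1 : 1 <= V n by rewrite ler_pdivlMr// mul1r survival_ge.
have V0 : 0 < V n by apply: lt_le_trans V1.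
have -> : iter (t n) (W n) (one n) n / iter (t n) (avg n) (one n) n = F n / V n.
  by rewrite /F /V -mulf_div divff ?invr_neq0 ?gt_eqF// mulr1.
rewrite (_ : _ - E = (F n - c n * B n + c n * (B n - E) - E * (V n - c n)) / V n).
  rewrite normrM normfV (gtr0_norm V0) ler_pdivrMr// ler_peMr//.
by field; rewrite gt_eqF.
Unshelve. all: by end_near. Qed.

End Ratio.

(** * From path probabilities to generating polynomials *)

Section VisitPoly.
Variables (R : realType) (n x : nat).

Definition visit_step (f : nat -> {poly R}) (y : nat) : {poly R} :=
  if inner n y then 2^-1 *: ('X^(y.-1 == x) * f y.-1 + 'X^(y.+1 == x) * f y.+1)
  else 0.

(* Generating polynomial of the number of visits to x in the next s steps of
   the walk started at y and killed at 0. *)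
Definition visit_poly (s : nat) : nat -> {poly R} :=
  iter s visit_step (fun y => (inner n y)%:R).

Lemma visit_poly_out s y : ~~ inner n y -> visit_poly s y = 0.
Proof.
by case: s => [|s] /negbTE h; rewrite /visit_poly /= /visit_step h.
Qed.

Lemma visit_poly_horner s y (z : R) :
  (visit_poly s y).[z] = iter s (wavg n (site_weight x z)) (inside R n) y.
Proof.
rewrite /visit_poly; elim: s y => [|s IH] y.
  by rewrite /= /inside; case: inner; rewrite hornerE.
rewrite !iterS /visit_step /wavg /avg; case: ifP => _; last by rewrite horner0.
rewrite hornerZ hornerD !hornerM !hornerXn !IH /site_weight.
by rewrite mulrC; congr ((_ * _ + _ * _) / _); case: eqP.
Qed.

Lemma visit_poly_coef_ge0 s y k : 0 <= (visit_poly s y)`_k.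
Proof.
rewrite /visit_poly; elim: s y k => [|s IH] y k.
  by rewrite /=; case: inner; rewrite ?coef1 ?coef0// ler0n.
rewrite iterS /visit_step; case: ifP => _; last by rewrite coef0.
by rewrite coefZ coefD !coefXnM mulr_ge0 ?invr_ge0// addr_ge0//; case: ifP.
Qed.

End VisitPoly.

Section RingWalk.
Variables (R : realType) (d : measure_display) (T : measurableType d).
Variables (P : probability T R) (n : nat) (X : nat -> {mfun T >-> nat}).
Hypothesis n2 : (1 < n)%N.
Hypothesis hX : is_ring_walk P n n X.

Let mX i (A : set nat) : measurable (X i @^-1` A).
Proof. by rewrite -[X in measurable X]setTI; exact: measurable_funP. Qed.

Definition prefix_event (m : nat) (u : nat -> nat) : set T :=
  [set w | forall s, (s <= m)%N -> X s w = u s].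

Definition path_weight (m : nat) (u : nat -> nat) : R :=
  (u 0%N == n)%:R * \prod_(s < m) ring_step R n (u s) (u s.+1).

Lemma measurable_prefix_event m u : measurable (prefix_event m u).
Proof.
rewrite (_ : prefix_event m u =
  \bigcap_(s in [set s | (s <= m)%N]) (X s @^-1` [set u s])) //.
by apply: bigcap_measurableType => s _; exact: mX.
Qed.

(** Recursion on the next step, to match [visit_step]; [future_eventP] gives the direct reading,
    over the times m + 1 to m + s. *)
Fixpoint future_event (x m s k : nat) : set T :=
  if s is s'.+1 then
    (X m.+1 @^-1` [set~ 0%N]) `&`
    ((X m.+1 @^-1` [set x] `&`
      (if k is k'.+1 then future_event x m.+1 s' k' else set0)) `|`
     (X m.+1 @^-1` [set~ x] `&` future_event x m.+1 s' k))
  else [set w | k = 0%N].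

Lemma measurable_future_event x m s k : measurable (future_event x m s k).
Proof.
elim: s m k => [|s IH] m k /=.
  case: k => [|k].
    by rewrite (_ : mkset _ = setT)//; apply/seteqP.
  by rewrite (_ : mkset _ = set0)//; apply/seteqP; split=> w /=.
apply: measurableI => //; apply: measurableU; apply: measurableI => //.
by case: k.
Qed.

Lemma future_eventP x m s k w : future_event x m s k w <->
  (forall i, (i < s)%N -> X (m + i.+1) w <> 0%N) /\
  (\sum_(i < s) (X (m + i.+1) w == x) = k)%N.
Proof.
elim: s m k => [|s IH] m k /=.
  by rewrite big_ord0; split=> [->|[_ <-]].
have addE i : (m + i.+2 = m.+1 + i.+1)%N by rewrite addnS.
rewrite big_ord_recl/= addn1; under eq_bigr do rewrite /bump/= add1n addE.
have IH0 : (forall i, (i < s)%N -> X (m.+1 + i.+1) w <> 0%N) /\ X m.+1 w <> 0%N <->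
    (forall i, (i < s.+1)%N -> X (m + i.+1) w <> 0%N).
  split=> [[H H0] [|i] /=|H]; first by rewrite addn1.
    by rewrite ltnS addE; exact: H.
  by split=> [i si|]; [rewrite -addE; exact: H|rewrite -addn1; exact: H].
case: eqP => xE /=.
- split=> [[H0 [[_]|[]//]]|[/IH0[H H0]]].
    by case: k => // k /IH[H <-]; split=> //; apply/IH0.
  by case: k => [//|k] [] Hk; split=> //; left; split=> //; apply/IH.
- split=> [[H0 [[]//|[_ /IH[H <-]]]]|[/IH0[H H0] Hk]].
    by split=> //; apply/IH0.
  by split=> //; right; split=> //; apply/IH.
Qed.

Let extend (m v : nat) (u : nat -> nat) (i : nat) : nat :=
  if (i <= m)%N then u i else v.

Let prefix_extend m v u :
  prefix_event m.+1 (extend m v u) = prefix_event m u `&` X m.+1 @^-1` [set v].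
Proof.
apply/seteqP; split=> w.
  move=> H; split=> [s sm|]; last by rewrite /= H// /extend ltnn.
  by rewrite H ?(leq_trans sm)// /extend sm.
move=> [H Hv] s; rewrite leq_eqVlt => /orP[/eqP ->|sm].
  by rewrite /extend ltnn.
by rewrite /extend -ltnS sm H.
Qed.

Let weight_extend m v u :
  path_weight m.+1 (extend m v u) = path_weight m u * ring_step R n (u m) v.
Proof.
rewrite /path_weight big_ord_recr/= mulrA /extend leq0n leqnn ltnn.
congr (_ * _ * _); apply: eq_bigr => i _.
by rewrite (ltnW (ltn_ord i)) ltn_ord.
Qed.

Let measure_split (A E1 E2 : set T) : measurable A -> measurable E1 ->
  measurable E2 -> E1 `&` E2 = set0 ->
  P A = (P (A `&` E1) + P (A `&` E2) + P (A `\` (E1 `|` E2)))%E.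
Proof.
move=> mA m1 m2 E12.
rewrite -measureU//; [|exact: measurableI|exact: measurableI|]; last first.
  by rewrite setIACA E12 setI0.
by rewrite -setIUr addeC -measureDI//; exact: measurableU.
Qed.

(** The Markov property in terms of path probabilities alone: each induction step appends one site
    to the prescribed prefix, whose weight gains a factor 1/2. *)
Lemma prefix_future x m s k u : inner n (u m) ->
  P (prefix_event m u `&` future_event x m s k) =
  (path_weight m u * (visit_poly R n x s (u m))`_k)%:E.
Proof.
elim: s m k u => [|s IH] m k u iu.
  rewrite /= iu coef1; case: k => [|k].
    rewrite mulr1 (_ : _ `&` _ = prefix_event m u) ?hX//.
    by apply/seteqP; split=> w; [case|].
  rewrite mulr0 (_ : _ `&` _ = set0) ?measure0//.
  by apply/seteqP; split=> w // -[].
have [y0 yn] := andP iu.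
set D := future_event x m s.+1 k; set A := prefix_event m u.
have mA : measurable A := measurable_prefix_event m u.
have mD : measurable D := measurable_future_event x m s.+1 k.
(* On the ring the right neighbour of 2n - 1 is 0, whereas [visit_step] uses 2n; [visit_poly]
   vanishes at both. *)
pose vm := (u m).-1; pose vp := if (u m).+1 == n.*2 then 0%N else (u m).+1.
have adjm : ring_step R n (u m) vm = 2^-1.
  by rewrite /ring_step /ring_adj yn /vm prednK// eqxx orbT (ltnW yn).
have adjp : ring_step R n (u m) vp = 2^-1.
  rewrite /ring_step /ring_adj yn /vp; case: eqP => [->|/eqP ne].
    by rewrite modnn mod0n eqxx (leq_ltn_trans _ yn).
  by rewrite eqxx ltn_neqAle ne yn.
have vpm : vp != vm.
  rewrite /vp /vm; case: ((u m).+1 =P n.*2) => [E|_]; last by lia.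
  by have := n2; lia.
pose Em := X m.+1 @^-1` [set vm]; pose Ep := X m.+1 @^-1` [set vp].
have Edisj : Em `&` Ep = set0.
  apply/seteqP; split=> w // -[/= e1 e2].
  by move: vpm; rewrite -e1 -e2 eqxx.
have mEm : measurable Em := mX _ _.
have mEp : measurable Ep := mX _ _.
have PE v : P (A `&` X m.+1 @^-1` [set v]) =
    (path_weight m u * ring_step R n (u m) v)%:E.
  by rewrite -prefix_extend -weight_extend; exact: hX.
have PA : P A = (path_weight m u)%:E by exact: hX.
(* the two neighbours exhaust the mass, so other values of X m.+1 are null *)
have rest0 : P (A `\` (Em `|` Ep)) = 0%E.
  have := measure_split mA mEm mEp Edisj.
  rewrite PA !PE adjm adjp -EFinD -mulrDr.
  have fin : P (A `\` (Em `|` Ep)) \is a fin_num.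
    by apply: fin_num_measure; apply: measurableD => //; exact: measurableU.
  rewrite -(fineK fin) -EFinD => -[]; have -> : 2^-1 + 2^-1 = 1 :> R by field.
  by rewrite mulr1 => /eqP; rewrite eq_sym addrC -subr_eq0 addrK => /eqP ->.
have AD : P (A `&` D) = (P (A `&` D `&` Em) + P (A `&` D `&` Ep))%E.
  rewrite (measure_split (measurableI _ _ mA mD) mEm mEp Edisj).
  rewrite [X in (_ + X)%E](_ : _ = 0%E) ?adde0//.
  apply/eqP; rewrite eq_le measure_ge0 andbT -rest0.
  by apply: le_measure; rewrite ?inE; [do 2?[apply: measurableD|apply: measurableI]..|
    move=> w [[? ?] ?]]; try exact: measurableU.
have step v : (v < n.*2)%N -> ring_step R n (u m) v = 2^-1 ->
    P (A `&` D `&` X m.+1 @^-1` [set v]) =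
    (path_weight m u * (2^-1 * ('X^(v == x) * visit_poly R n x s v)`_k))%:E.
  move=> vn adj; have -> : A `&` D `&` X m.+1 @^-1` [set v] =
      prefix_event m.+1 (extend m v u) `&` D.
    by rewrite prefix_extend setIAC.
  (* A step to the origin contradicts avoidance on the left and meets a zero polynomial on the
     right. *)
  have [v0|v0] := posnP v.
    rewrite v0 visit_poly_out// mulr0 coef0 !mulr0.
    rewrite (_ : _ `&` _ = set0) ?measure0//; apply/seteqP; split=> w //.
    by rewrite prefix_extend => -[[_ Xv] [X0 _]]; exact: X0.
  have iv : inner n v by rewrite /inner v0.
  have ext : extend m v u m.+1 = v by rewrite /extend ltnn.
  rewrite coefXnM; have [vx|vx] := eqVneq v x; last first.
    rewrite subn0 ltn0 mulrA -adj -weight_extend -{3}ext -IH ?ext//.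
    congr (P _); apply/seteqP; split=> w [] pw.
      have Xv : X m.+1 w = v by move: pw; rewrite prefix_extend => -[].
      by case=> _ [[/= Xx]|[_ ?]]//; move: vx; rewrite -Xv Xx eqxx.
    have Xv : X m.+1 w = v by move: pw; rewrite prefix_extend => -[].
    move=> f; split=> //; split=> /=.
      by rewrite Xv; apply/eqP; rewrite -lt0n.
    by right; split=> //; rewrite /= Xv; exact/eqP.
  case: k @D mD AD => [|k] D mD AD.
    rewrite ltnS leqnn !mulr0 (_ : _ `&` _ = set0) ?measure0//.
    apply/seteqP; split=> w // [pw].
    have Xv : X m.+1 w = v by move: pw; rewrite prefix_extend => -[].
    by case=> _ [[_ []]|[/= Xx _]]; apply: Xx; rewrite Xv.
  rewrite ltnS ltn0 subn1 mulrA -adj -weight_extend -{3}ext -IH ?ext//.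
  congr (P _); apply/seteqP; split=> w [] pw.
    have Xv : X m.+1 w = v by move: pw; rewrite prefix_extend => -[].
    by case=> _ [[_ ?]|[/= Xx _]]//; case: Xx; rewrite Xv.
  have Xv : X m.+1 w = v by move: pw; rewrite prefix_extend => -[].
  move=> f; split=> //; split=> /=.
    by rewrite Xv; apply/eqP; rewrite -lt0n.
  by left; split=> //; rewrite /= Xv.
rewrite AD (step vm)//; last by rewrite (leq_ltn_trans (leq_pred _)).
rewrite (step vp)//; last by rewrite /vp; case: eqP => [?|/eqP ne]; lia.
rewrite -EFinD -mulrDr -mulrDr; congr (_ * _)%:E.
rewrite /visit_poly iterS -/(visit_poly R n x s) /visit_step iu coefZ coefD.
congr (_ * (_ + _)); rewrite /vp; case: ((u m).+1 =P n.*2) => // E.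
by rewrite !visit_poly_out ?mulr0// /inner E ltnn andbF.
Qed.

(** [future_event] ignores time 0, where the walk is almost surely at n: neither a visit to x nor
    the origin. Intersecting with that almost sure event reduces the claim to [prefix_future]. *)
Lemma visits_avoiding x t k : x != n ->
  P (avoids_origin X t `&` (local_time R X t x @^-1` [set k%:R])) =
  ((visit_poly R n x t n)`_k)%:E.
Proof.
move=> xn; pose u := fun _ : nat => n.
have iu : inner n (u 0%N) by rewrite /inner /u; lia.
have := prefix_future x t k iu.
rewrite /path_weight big_ord0 eqxx !mul1r => <-.
have P0 : P (prefix_event 0 u) = 1%E.
  by rewrite hX big_ord0 eqxx mulr1.
set B := (_ `&` _ in LHS); set A := prefix_event 0 u.
have mA : measurable A := measurable_prefix_event 0 u.
have mB : measurable B.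
  apply: measurableI; first exact: measurable_avoids_origin.
  rewrite -[X in measurable X]setTI; exact: (measurable_local_time _ _ _ measurableT).
have PAC : P (~` A) = 0%E by rewrite probability_setC// P0 subee.
have -> : P B = P (B `&` A).
  rewrite [LHS](measureDI P mB mA).
  rewrite [X in (X + _)%E](_ : _ = 0%E) ?add0e//.
  apply/eqP; rewrite eq_le measure_ge0 andbT -PAC.
  apply: le_measure; rewrite ?inE; [exact: measurableD|exact: measurableC|].
  by move=> w [].
congr (P _); apply/seteqP; split=> w.
  move=> [[av lt] pw]; split=> //; apply/future_eventP; split.
    by move=> i it; rewrite add0n; exact: av.
  move/eqP: lt; rewrite eqr_nat big_ord_recl (pw 0%N)// /u [n == x]eq_sym (negbTE xn).
  by move/eqP.
move=> [pw /future_eventP[av lt]]; split=> //; split.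
  case=> [_|i it]; first by rewrite (pw 0%N)// /u; lia.
  by have := av i it; rewrite add0n.
rewrite /= /local_time big_ord_recl (pw 0%N)// /u [n == x]eq_sym (negbTE xn) add0n.
by congr (_%:R).
Qed.

(** The case of no visit to the site 0. The coefficient of degree 0 is the value at z = 0, and a
    zero weight at the origin changes nothing, as the iterated functions vanish there. *)
Lemma avoiding_prob t : P (avoids_origin X t) = (iter t (avg n) (inside R n) n)%:E.
Proof.
have n0 : 0%N != n by lia.
have := visits_avoiding t 0 n0; rewrite -horner_coef0 visit_poly_horner => H.
transitivity (P (avoids_origin X t `&` local_time R X t 0 @^-1` [set 0%:R])).
  congr (P _); apply/seteqP; split=> w; last by case.
  move=> av; split=> //; rewrite /= /local_time big1// => i _.
  by apply/eqP; rewrite eqb0; apply/eqP; apply: av; rewrite -ltnS.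
rewrite H; congr EFin; move: {H}t.
suff E t y : iter t (wavg n (site_weight 0 0)) (inside R n) y =
    iter t (avg n) (inside R n) y by move=> t; exact: E.
elim: t y => // t IH y; rewrite !iterS /wavg.
suff -> : (fun v => site_weight 0 0 v * iter t (wavg n (site_weight 0 0)) (inside R n) v)
    = iter t (avg n) (inside R n) by [].
apply/funext => v; rewrite IH /site_weight.
case: eqP => [->|_]; last by rewrite mul1r.
by rewrite mul0r; case: t {IH}.
Qed.

End RingWalk.

(** * Convergence of point masses *)

Section Atoms.
Variables (R : realType) (d : measure_display) (T : measurableType d).
Variables (P : probability T R) (X : {mfun T >-> R}) (f : R -> R) (M : R).
Hypotheses (cf : continuous f) (fM : forall r, `|f r| <= M).

Definition off_naturals (J : nat) : set T :=
  [set w | forall k, (k < J)%N -> X w <> k%:R].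

Let mX (A : set R) : measurable A -> measurable (X @^-1` A).
Proof. by move=> mA; rewrite -[X in measurable X]setTI; exact: measurable_funP. Qed.

Lemma off_naturalsS J : off_naturals J = off_naturals J.+1 `|` X @^-1` [set J%:R].
Proof.
apply/seteqP; split=> w.
  move=> H; have [rJ|rJ] := pselect (X w = J%:R); first by right.
  left=> k; rewrite ltnS leq_eqVlt => /orP[/eqP -> //|]; exact: H.
move=> [H k kJ|/= Xw k kJ]; first by apply: H; exact: ltnW.
by rewrite Xw => /eqP; rewrite eqr_nat gtn_eqF.
Qed.

Lemma measurable_off_naturals J : measurable (off_naturals J).
Proof.
rewrite (_ : off_naturals J =
  \bigcap_(k in [set k | (k < J)%N]) ~` (X @^-1` [set k%:R])) //.
by apply: bigcap_measurableType => k _; apply: measurableC; apply: mX.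
Qed.

Lemma bounded_integrable (g : R -> R) (K : R) (D : set T) : continuous g ->
  (forall r, `|g r| <= K) -> measurable D -> P.-integrable D (EFin \o (g \o X)).
Proof.
move=> cg gK mD; apply: (@le_integrable _ _ _ _ _ mD _ (EFin \o cst K)).
- apply/measurable_EFinP; apply: measurable_funTS; apply: measurableT_comp => //.
  exact: continuous_measurable_fun.
- by move=> r _; rewrite lee_fin (le_trans (gK _))// ler_norm.
- exact: finite_measure_integrable_cst.
Qed.

Lemma integral_split_atoms (g : R -> R) (K : R) J : continuous g ->
  (forall r, `|g r| <= K) ->
  \int[P]_w g (X w) = \int[P]_(w in off_naturals J) g (X w)
    + \sum_(k < J) g k%:R * fine (P (X @^-1` [set k%:R])).
Proof.
move=> cg gK; elim: J => [|J ->].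
  by rewrite big_ord0 addr0 (_ : off_naturals 0 = setT)//; apply/seteqP.
rewrite big_ord_recr/= off_naturalsS Rintegral_setU//; first last.
- by apply/disj_setPS => r [H /= rJ]; exact: (H J (leqnn _) rJ).
- apply: (bounded_integrable cg gK); apply: measurableU; last by apply: mX.
  exact: measurable_off_naturals.
- exact: measurable_off_naturals.
rewrite -addrA; congr (_ + _); rewrite addrC; congr (_ + _).
rewrite -Rintegral_cst; last by apply: mX.
by apply: eq_Rintegral => w; rewrite inE /= => ->.
Qed.

(** The same splitting, applied to the constant 1, identifies the mass left outside the first [J]
    naturals. *)
Lemma integral_atoms J :
  `|\int[P]_w f (X w) - \sum_(k < J) f k%:R * fine (P (X @^-1` [set k%:R]))| <=
  M * (1 - \sum_(k < J) fine (P (X @^-1` [set k%:R]))).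
Proof.
have c1 : continuous (cst 1 : R -> R) by move=> r; exact: cvg_cst.
have b1 (r : R) : `|cst 1 r : R| <= 1 by rewrite normr1.
have := integral_split_atoms J c1 b1.
rewrite Rintegral_cst// -[fine _]/(fine (P setT)) probability_setT [fine _]/= mulr1.
rewrite Rintegral_cst; last exact: measurable_off_naturals.
rewrite mul1r; under eq_bigr do rewrite mul1r.
move=> E; rewrite [X in M * (X - _)]E addrK (integral_split_atoms J cf fM) addrK.
have mD := measurable_off_naturals J.
rewrite (le_trans (le_normr_Rintegral mD _))//.
  exact: (bounded_integrable cf fM).
rewrite -Rintegral_cst//; apply: le_Rintegral => //.
- have := bounded_integrable cf fM mD; exact: integrable_norm.
- exact: finite_measure_integrable_cst.
Qed.

End Atoms.

Section NatLaw.
Variable R : realType.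

Lemma cvg_ord_sum (u : nat -> nat -> R) (l : nat -> R) (J : nat) :
  (forall k, (k < J)%N -> u n k @[n --> \oo] --> l k) ->
  (\sum_(k < J) u n k) @[n --> \oo] --> \sum_(k < J) l k.
Proof.
elim: J => [|J IH] H.
  by rewrite big_ord0; under eq_cvg do rewrite big_ord0; exact: cvg_cst.
rewrite big_ord_recr/=; under eq_cvg do rewrite big_ord_recr/=.
apply: cvgD; last exact: H.
by apply: IH => k kJ; apply: H; exact: ltnW.
Qed.

Lemma sum_atoms_cvg1 (d : measure_display) (T : measurableType d)
    (Q : probability T R) (Y : {mfun T >-> R}) :
  (forall w, exists k : nat, Y w = k%:R) ->
  (\sum_(k < J) fine (Q (Y @^-1` [set k%:R]))) @[J --> \oo] --> (1 : R).
Proof.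
move=> Ynat.
have mA k : measurable (Y @^-1` [set k%:R]).
  by rewrite -[X in measurable X]setTI; exact: measurable_funP.
have U : \bigcup_k (Y @^-1` [set k%:R]) = setT.
  by apply/seteqP; split=> // w _; have [k Yk] := Ynat w; exists k.
have tr : trivIset setT (fun k : nat => Y @^-1` [set k%:R]).
  apply/trivIsetP => i j _ _ ij; apply/seteqP; split=> w // -[/= -> /eqP].
  by rewrite eqr_nat (negbTE ij).
have mU : measurable (\bigcup_k (Y @^-1` [set k%:R])) by rewrite U.
have H : (\sum_(0 <= k < J) Q (Y @^-1` [set k%:R]))%E @[J --> \oo] --> 1%:E.
  by rewrite -(probability_setT Q) -U; exact: measure_semi_sigma_additive.
have H1 : fine (\sum_(0 <= k < J) Q (Y @^-1` [set k%:R]))%E @[J --> \oo] --> (1 : R).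
  exact: fine_cvg H.
apply: cvg_trans H1; apply: near_eq_cvg; near=> J.
rewrite /= -sum_fine; last by move=> k _; exact: fin_num_measure.
by rewrite big_mkord.
Unshelve. all: by end_near. Qed.

(** Tightness comes from the limit: its atoms sum to 1, so finitely many carry almost all its mass,
    and by convergence of these atoms they eventually carry almost all the mass of [X n]. *)
Lemma pmf_cvg_in_law
    (d : nat -> measure_display) (T : forall n, measurableType (d n))
    (P : forall n, probability (T n) R) (X : forall n, {mfun T n >-> R})
    (d' : measure_display) (T' : measurableType d')
    (Q : probability T' R) (Y : {mfun T' >-> R}) :
  (forall w, exists k : nat, Y w = k%:R) ->
  (forall k : nat, fine (P n (X n @^-1` [set k%:R])) @[n --> \oo] -->
    fine (Q (Y @^-1` [set k%:R]))) ->
  cvg_in_law P X Q Y.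
Proof.
move=> Ynat pq f cf [M fM].
have M0 : 0 <= M by apply: le_trans (fM 0).
have fin d1 (T1 : measurableType d1) (P1 : probability T1 R) (X1 : {mfun T1 >-> R}) :
    (\int[distribution P1 X1]_r (f r)%:E)%E = (\int[P1]_w f (X1 w))%:E.
  have int1 := bounded_integrable P1 X1 cf fM measurableT.
  rewrite integral_distribution//.
    by rewrite fineK//; exact: integrable_fin_num.
  by apply/measurable_EFinP; exact: continuous_measurable_fun.
rewrite fin (_ : (fun n => _) = fun n => (\int[P n]_w f (X n w))%:E); last first.
  by apply/funext => n; rewrite fin.
apply: cvg_EFin; first by apply: nearW.
pose p n k := fine (P n (X n @^-1` [set k%:R])).
pose q k := fine (Q (Y @^-1` [set k%:R])).
have Ip n J : `|\int[P n]_w f (X n w) - \sum_(k < J) f k%:R * p n k| <=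
    M * (1 - \sum_(k < J) p n k) by exact: integral_atoms.
have Iq J : `|\int[Q]_w f (Y w) - \sum_(k < J) f k%:R * q k| <=
    M * (1 - \sum_(k < J) q k) by exact: integral_atoms.
apply/cvgrPdist_lt => e e0.
have [J qJ] : exists J, M * (1 - \sum_(k < J) q k) < e / 4.
  have := @sum_atoms_cvg1 _ _ Q Y Ynat => H.
  have H2 : (M * (1 - \sum_(k < J) q k)) @[J --> \oo] --> M * (1 - 1).
    by apply: cvgM; [exact: cvg_cst|apply: cvgB => //; exact: cvg_cst].
  rewrite subrr mulr0 in H2.
  have e4 : 0 < e / 4 by rewrite divr_gt0.
  have [J _ HJ] := cvgr_lt 0 H2 _ e4.
  by exists J; apply: HJ => /=.
have S1 : (\sum_(k < J) p n k) @[n --> \oo] --> \sum_(k < J) q k.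
  by apply: (cvg_ord_sum (u := p) (l := q)) => k _; exact: pq.
have S2 : (\sum_(k < J) f k%:R * p n k) @[n --> \oo] --> \sum_(k < J) f k%:R * q k.
  apply: (cvg_ord_sum (u := fun n k => f k%:R * p n k) (l := fun k => f k%:R * q k)).
  by move=> k _; apply: cvgM; [exact: cvg_cst|exact: pq].
have S3 : (M * (1 - \sum_(k < J) p n k)) @[n --> \oo] --> M * (1 - \sum_(k < J) q k).
  by apply: cvgM; [exact: cvg_cst|apply: cvgB => //; exact: cvg_cst].
have e4 : 0 < e / 4 by rewrite divr_gt0.
near=> n.
have b1 : `|\sum_(k < J) f k%:R * q k - \sum_(k < J) f k%:R * p n k| < e / 4.
  by near: n; move/cvgrPdist_lt: S2; apply.
have b2 : M * (1 - \sum_(k < J) p n k) < e / 4.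
  by near: n; exact: (cvgr_lt _ S3).
rewrite /=; move: b1 (le_lt_trans (Ip n J) b2) (le_lt_trans (Iq J) qJ).
move: (\int[_]_w f (Y w)) (\int[_]_w f (X n w)) => u v.
move: (\sum_(_ < _) _ * q _) (\sum_(_ < _) _ * p n _) => u' v'.
rewrite !ltr_norml => /andP[h1 h2] /andP[h3 h4] /andP[h5 h6].
by apply/andP; split; lra.
Unshelve. all: by end_near. Qed.

End NatLaw.

(** * Generating functions *)

Section CoefficientLimits.
Variable R : realType.
Implicit Types (p : {poly R}) (z : R).

Lemma horner_trunc_le p z J : (forall k, 0 <= p`_k) -> p.[1] <= 1 ->
  0 <= z <= 1 -> `|p.[z] - \sum_(k < J) p`_k * z ^+ k| <= z ^+ J.
Proof.
move=> p0 p1 /andP[z0 z1]; pose N := (size p)%N.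
have sz : (size p <= J + N)%N by rewrite leq_addl.
rewrite (horner_coef_wide _ sz) big_split_ord/= addrAC subrr add0r.
rewrite ger0_norm; last by apply: sumr_ge0 => i _; rewrite mulr_ge0// exprn_ge0.
apply: (@le_trans _ _ (z ^+ J * \sum_(i < N) p`_(J + i))).
  rewrite mulr_sumr; apply: ler_sum => i _; rewrite exprD mulrCA ler_wpM2l ?exprn_ge0//.
  by rewrite ler_piMr// exprn_ile1.
rewrite ler_piMr ?exprn_ge0//; apply: le_trans p1.
rewrite (horner_coef_wide _ sz) big_split_ord/=.
under [X in _ <= _ + X]eq_bigr do rewrite expr1n mulr1.
by rewrite lerDr; apply: sumr_ge0 => i _; rewrite expr1n mulr1.
Qed.

(** Induction on the degree: subtract the lower coefficients, already known to converge, and divide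
    by the J-th power. What remains is the J-th coefficient up to an error of the order of the
    evaluation point, which can be taken small. The points [zs n] move because the site weight
    depends on n. *)
Lemma coef_cvg (p : nat -> {poly R}) (q : nat -> R) (Phi : R -> R) :
  (\forall n \near \oo, (forall k, 0 <= (p n)`_k) /\ (p n).[1] <= 1) ->
  (forall z, 0 < z < 1 -> exists zs : nat -> R,
    zs n @[n --> \oo] --> z /\ (p n).[zs n] @[n --> \oo] --> Phi z) ->
  (forall J, exists C, forall z : R, 0 < z <= 1 / 2 ->
    `|Phi z - \sum_(k < J.+1) q k * z ^+ k| <= C * z ^+ J.+1) ->
  forall k, (p n)`_k @[n --> \oo] --> q k.
Proof.
move=> hp hz hq; elim/ltn_ind => J IH.
have [C HC] := hq J; apply/cvgrPdist_lt => e e0.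
pose D := `|C| + 1; have D0 : 0 < D by rewrite ltr_wpDl.
(* Since [D] exceeds both [C] and 0 by at least 1 in the sense D = |C| + 1, this makes both C z and
   z at most e / 4. *)
pose z := Num.min (1 / 2) (e / (4 * D)).
have z0 : 0 < z by rewrite lt_min divr_gt0//= divr_gt0// mulr_gt0.
have z12 : z <= 1 / 2 by rewrite ge_min lexx.
have zD : z * D <= e / 4.
  rewrite -ler_pdivlMr// (_ : e / 4 / D = e / (4 * D)); last by field; rewrite gt_eqF.
  by rewrite ge_min lexx orbT.
have z1 : z < 1 by lra.
have [|zs [zsz pz]] := hz z; first by rewrite z0.
have zJ : z ^+ J != 0 by rewrite expf_neq0// gt_eqF.
have zsX k : (zs n ^+ k) @[n --> \oo] --> z ^+ k.
  elim: k => [|k IHk]; first by under eq_cvg do rewrite expr0; rewrite expr0; exact: cvg_cst.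
  by under eq_cvg do rewrite exprS; rewrite exprS; exact: cvgM.
pose A n := ((p n).[zs n] - \sum_(i < J) (p n)`_i * zs n ^+ i) / zs n ^+ J.
pose L := (Phi z - \sum_(i < J) q i * z ^+ i) / z ^+ J.
have AL : A n @[n --> \oo] --> L.
  apply: cvgM; last by apply: cvgV => //; exact: zsX.
  apply: cvgB => //.
  apply: (@cvg_ord_sum R (fun n i => (p n)`_i * zs n ^+ i) (fun i => q i * z ^+ i)).
  by move=> i iJ; apply: cvgM; [exact: IH|exact: zsX].
have Lq : `|L - q J| <= e / 4.
  have -> : L - q J = (Phi z - \sum_(i < J.+1) q i * z ^+ i) / z ^+ J.
    by rewrite /L big_ord_recr/=; field; exact: zJ.
  have zJ0 : 0 < z ^+ J by rewrite exprn_gt0.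
  rewrite normrM normfV (gtr0_norm zJ0) ler_pdivrMr//.
  have hzz : 0 < z <= 1 / 2 by rewrite z0.
  apply: (le_trans (HC z hzz)); rewrite exprS mulrA ler_pM2r// (le_trans _ zD)//.
  rewrite mulrC ler_pM2l// (le_trans (ler_norm _))// /D; lra.
have e4 : 0 < e / 4 by rewrite divr_gt0.
near=> n.
have [pn0 pn1] : (forall k, 0 <= (p n)`_k) /\ (p n).[1] <= 1 by near: n.
have zs0 : 0 < zs n by near: n; exact: (cvgr_gt z).
have zs1 : zs n < z + e / 4 by near: n; apply: (cvgr_lt z) => //; rewrite ltrDl.
have zs2 : zs n < 1 by near: n; exact: (cvgr_lt z).
have Ad : `|L - A n| < e / 4 by near: n; move/cvgrPdist_lt: AL; apply.
have zsJ : 0 < zs n ^+ J by rewrite exprn_gt0.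
have Ap : `|A n - (p n)`_J| <= zs n.
  have -> : A n - (p n)`_J =
      ((p n).[zs n] - \sum_(i < J.+1) (p n)`_i * zs n ^+ i) / zs n ^+ J.
    by rewrite /A big_ord_recr/=; field; rewrite gt_eqF.
  rewrite normrM normfV (gtr0_norm zsJ) ler_pdivrMr// -exprS.
  by apply: horner_trunc_le => //; rewrite !ltW.
have zD' : z <= z * D by rewrite ler_pMr// /D lerDr.
move: Ad Ap Lq; rewrite !ler_norml !ltr_norml => /andP[? ?] /andP[? ?] /andP[? ?].
apply/andP; split; lra.
Unshelve. all: by end_near. Qed.

End CoefficientLimits.

(** * Power series of the compound Poisson law *)

Section CompoundPoissonSeries.
Variables (R : realType) (rate pr : R).
Hypotheses (rate0 : 0 < rate) (pr0 : 0 < pr) (pr1 : pr < 1).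

Definition geom_pgf (z : R) : R := pr * z / (1 - (1 - pr) * z).

Definition compound_pgf (z : R) : R := expR (- (rate * (1 - geom_pgf z))).

Definition geom_poly (J : nat) : {poly R} :=
  \poly_(i < J) (if i is i'.+1 then pr * (1 - pr) ^+ i' else 0).

(** Truncated both in the Poisson index and in the geometric degrees. The coefficients below [J] are
    still exact, since each geometric variable is at least 1 and [m] of them contribute only to
    degrees at least [m]. *)
Definition compound_poly (J : nat) : {poly R} :=
  \sum_(m < J) poisson_pmf rate m *: geom_poly J ^+ m.

Lemma expR_taylor_le (y : R) J : 0 <= y ->
  `|expR y - \sum_(m < J) y ^+ m / m`!%:R| <= y ^+ J * expR y.
Proof.
move=> y0; have le_exp N : \sum_(m < N) y ^+ m / m`!%:R <= expR y.
  have := @nondecreasing_cvgn_le R (series (exp_coeff y)) _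
    (@is_cvg_series_exp_coeff R y) N.
  rewrite /series/= big_mkord; apply.
  apply/nondecreasing_seqP => k; rewrite /series/= big_nat_recr//= lerDl.
  by rewrite /exp_coeff/= divr_ge0// exprn_ge0.
rewrite ger0_norm ?subr_ge0//.
rewrite lerBlDr; apply: limr_le; first exact: is_cvg_series_exp_coeff.
near=> N; rewrite /series/= big_mkord.
have JN : (J <= N)%N by near: N; exact: nbhs_infty_ge.
rewrite -(subnKC JN) big_split_ord/= addrC lerD2r.
apply: (@le_trans _ _ (y ^+ J * \sum_(i < N - J) y ^+ i / i`!%:R)); last first.
  by rewrite ler_wpM2l ?exprn_ge0.
rewrite mulr_sumr; apply: ler_sum => i _; rewrite /exp_coeff/= exprD -mulrA.
rewrite ler_wpM2l ?exprn_ge0// ler_wpM2l ?exprn_ge0//.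
(* The tail is y^J times a series dominated by exp y, because (J + i)! >= i!. *)
rewrite lef_pV2 ?posrE ?ltr0n ?fact_gt0// ler_nat.
by rewrite leq_fact// leq_addl.
Unshelve. all: by end_near. Qed.

Lemma expr_sub_le (u v : R) m : 0 <= u -> u <= v -> v <= 1 ->
  v ^+ m - u ^+ m <= m%:R * (v - u).
Proof.
move=> u0 uv v1; elim: m => [|m IH]; first by rewrite !expr0 subrr mul0r.
have u1 : u <= 1 by exact: le_trans v1.
have vm : 0 <= v ^+ m <= 1.
  by rewrite exprn_ge0 ?exprn_ile1//; exact: le_trans uv.
have um : 0 <= u ^+ m <= v ^+ m.
  rewrite exprn_ge0//=; apply: lerXn2r => //; rewrite ?nnegrE//; exact: le_trans uv.
have -> : v ^+ m.+1 - u ^+ m.+1 = v ^+ m * (v - u) + u * (v ^+ m - u ^+ m).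
  by rewrite !exprS; ring.
rewrite -natr1 mulrDl mul1r addrC; apply: lerD.
  rewrite -[leRHS]mul1r; apply: ler_pM => //; rewrite subr_ge0; by case/andP: um.
by rewrite ler_piMl ?subr_ge0//; case/andP: vm.
Qed.

Lemma geom_poly_horner J (z : R) : 0 <= z <= 1 / 2 ->
  geom_pgf z - (geom_poly J.+1).[z] = pr * z * ((1 - pr) * z) ^+ J / (1 - (1 - pr) * z).
Proof.
move=> /andP[z0 z1].
have d0 : 1 - (1 - pr) * z != 0.
  have p1 : 1 - pr <= 1 by move: pr0; lra.
  have h : (1 - pr) * z <= 1 * z by rewrite ler_wpM2r// ?ltW.
  by rewrite gt_eqF//; lra.
have -> : (geom_poly J.+1).[z] = \sum_(i < J) pr * z * ((1 - pr) * z) ^+ i.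
  rewrite horner_poly big_ord_recl/= mul0r add0r; apply: eq_bigr => i _.
  by rewrite /bump/= add1n exprS exprMn; ring.
elim: J => [|J IH]; first by rewrite big_ord0 subr0 expr0 mulr1.
rewrite big_ord_recr/= opprD addrA IH exprS; field; exact: d0.
Qed.

(** Three errors of order z^(J+1): the coefficients of degree above J ([b1]), the truncated
    geometric series ([b2]), and the truncated Poisson series ([b3]), the last because
    [geom_pgf z <= 2 * z]. The bound z <= 1/2 keeps the denominator of [geom_pgf] at least 1/2. *)
Lemma compound_poly_approx J : exists C, forall z : R, 0 < z <= 1 / 2 ->
  `|compound_pgf z - \sum_(k < J.+1) (compound_poly J.+1)`_k * z ^+ k|
  <= C * z ^+ J.+1.
Proof.
set H := compound_poly J.+1; set g := geom_poly J.+1.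
pose C1 : R := \sum_(i < size (drop_poly J.+1 H)) `|(drop_poly J.+1 H)`_i|.
pose C2 : R := \sum_(m < J.+1) poisson_pmf rate m * m%:R * 2.
pose C3 : R := expR (- rate) * ((2 * rate) ^+ J.+1 * expR (2 * rate)).
exists (C1 + (C2 + C3)) => z /andP[z0 z12].
have p0 := pr0; have p1' := pr1.
have zz : 0 <= z <= 1 / 2 by rewrite ltW.
have d0 : 1 / 2 <= 1 - (1 - pr) * z.
  have p1 : 1 - pr <= 1 by move: pr0; lra.
  have h : (1 - pr) * z <= 1 * z by rewrite ler_wpM2r// ?ltW.
  by lra.
have d1 : 0 < 1 - (1 - pr) * z by lra.
have gp := geom_poly_horner J zz; rewrite -/g in gp.
have r01 : 0 <= (1 - pr) * z <= z.
  by rewrite mulr_ge0//= ?ler_piMl//; lra.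
have [r0 r1] := andP r01.
have zJ : 0 < z ^+ J.+1 by rewrite exprn_gt0.
have gap0 : 0 <= geom_pgf z - g.[z].
  by rewrite gp divr_ge0 ?(ltW d1)// mulr_ge0 ?exprn_ge0// mulr_ge0// ltW.
have gap1 : geom_pgf z - g.[z] <= 2 * z ^+ J.+1.
  rewrite gp ler_pdivrMr// exprS.
  have : ((1 - pr) * z) ^+ J <= z ^+ J by apply: lerXn2r; rewrite ?nnegrE// ltW.
  move=> h; have h2 : pr * z * ((1 - pr) * z) ^+ J <= 1 * z * z ^+ J.
    apply: ler_pM => //; rewrite ?mulr_ge0 ?exprn_ge0 ?(ltW z0) ?(ltW pr0)//.
    by rewrite ler_pM2r// ltW.
  apply: (le_trans h2); rewrite mul1r -exprS -/(z ^+ J.+1) mulrAC.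
  have : z ^+ J.+1 * (1 / 2) <= z ^+ J.+1 * (1 - (1 - pr) * z) by rewrite ler_pM2l.
  lra.
have g0 : 0 <= g.[z].
  rewrite /g horner_poly; apply: sumr_ge0 => -[[|i] _] _ /=; first by rewrite mul0r.
  by rewrite !mulr_ge0 ?exprn_ge0 ?(ltW z0) ?(ltW pr0)//; lra.
have G1 : geom_pgf z <= 1.
  by rewrite /geom_pgf ler_pdivrMr// mul1r; lra.
have G0 : 0 <= geom_pgf z by lra.
have G2 : geom_pgf z <= 2 * z.
  rewrite /geom_pgf ler_pdivrMr//.
  have : z * (1 / 2) <= z * (1 - (1 - pr) * z) by rewrite ler_pM2l.
  have : pr * z <= 1 * z by rewrite ler_pM2r// ltW.
  lra.
have HE : H.[z] = \sum_(m < J.+1) poisson_pmf rate m * g.[z] ^+ m.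
  by rewrite /H /compound_poly horner_sum; apply: eq_bigr => m _; rewrite hornerZ horner_exp.
have trunc : \sum_(k < J.+1) H`_k * z ^+ k = H.[z] - (drop_poly J.+1 H).[z] * z ^+ J.+1.
  rewrite -{2}(poly_take_drop J.+1 H) hornerD hornerM hornerXn addrK.
  rewrite (horner_coef_wide _ (size_take_poly _ _)); apply: eq_bigr => k _.
  by rewrite coef_take_poly ltn_ord.
have b1 : `|(drop_poly J.+1 H).[z] * z ^+ J.+1| <= C1 * z ^+ J.+1.
  rewrite normrM (gtr0_norm zJ) ler_pM2r// horner_coef.
  rewrite (le_trans (ler_norm_sum _ _ _))//; apply: ler_sum => i _.
  rewrite normrM ler_piMr// ger0_norm ?exprn_ge0 ?exprn_ile1 ?(ltW z0)//; lra.
have b2 : `|\sum_(m < J.+1) poisson_pmf rate m * geom_pgf z ^+ m - H.[z]|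
    <= C2 * z ^+ J.+1.
  rewrite HE -sumrB (le_trans (ler_norm_sum _ _ _))// mulr_suml.
  apply: ler_sum => m _; rewrite -mulrBr normrM.
  rewrite ger0_norm ?poisson_pmf_ge0// -!mulrA ler_wpM2l ?poisson_pmf_ge0//.
  have h := expr_sub_le m g0 (_ : g.[z] <= geom_pgf z) G1.
  have gG : g.[z] <= geom_pgf z by rewrite -subr_ge0.
  rewrite ger0_norm; last first.
    by rewrite subr_ge0; apply: lerXn2r; rewrite ?nnegrE.
  by apply: (le_trans (h gG)); rewrite ler_wpM2l.
have b3 : `|compound_pgf z - \sum_(m < J.+1) poisson_pmf rate m * geom_pgf z ^+ m|
    <= C3 * z ^+ J.+1.
  have y0 : 0 <= rate * geom_pgf z by rewrite mulr_ge0// ltW.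
  have -> : compound_pgf z - \sum_(m < J.+1) poisson_pmf rate m * geom_pgf z ^+ m =
      expR (- rate) * (expR (rate * geom_pgf z) -
        \sum_(m < J.+1) (rate * geom_pgf z) ^+ m / m`!%:R).
    rewrite mulrBr -expRD mulr_sumr /compound_pgf; congr (expR _ - _); first by ring.
    apply: eq_bigr => m _; rewrite /poisson_pmf rate0 [in RHS]exprMn.
    move: (expR _) (rate ^+ m) (geom_pgf z ^+ m) (_`!%:R^-1) => e a b c.
    by ring.
  rewrite normrM (ger0_norm (expR_ge0 _)) /C3 -mulrA ler_pM2l ?expR_gt0//.
  apply: (le_trans (expR_taylor_le J.+1 y0)).
  have yz : rate * geom_pgf z <= 2 * rate * z.
    by rewrite (_ : 2 * rate * z = rate * (2 * z)); [rewrite ler_pM2l|ring].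
  rewrite mulrAC -exprMn; apply: ler_pM; rewrite ?exprn_ge0 ?expR_ge0//.
    by apply: lerXn2r; rewrite ?nnegrE// (le_trans y0).
  rewrite ler_expR (le_trans yz)// ler_piMr ?mulr_ge0 ?(ltW rate0)//; lra.
rewrite trunc mulrDl mulrDl.
move: b1 b2 b3; rewrite !ler_norml => /andP[? ?] /andP[? ?] /andP[? ?].
by apply/andP; split; lra.
Unshelve. all: by end_near. Qed.

End CompoundPoissonSeries.

(** * Law of the local time of the interlacements *)

Section InterlacementLaw.
Variables (R : realType) (alpha : R) (x : nat) (d : measure_display).
Variables (T : measurableType d) (Q : probability T R).
Variables (N : {mfun T >-> nat}) (V : nat -> {mfun T >-> nat}).
Hypotheses (x0 : (0 < x)%N) (hNV : interlacement_visits alpha x Q N V).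

Local Notation pr := ((2 * x%:R)^-1 : R).
Local Notation rate := (alpha * x%:R / 2 : R).

Let mZ (Z : {mfun T >-> nat}) (A : set nat) : measurable (Z @^-1` A).
Proof. by rewrite -[X in measurable X]setTI; exact: measurable_funP. Qed.

Let pr_itv : 0 < pr < 1.
Proof.
have xR : 1 <= x%:R :> R by rewrite ler1n.
by rewrite invr_gt0 invf_lt1; [apply/andP; split; lra|lra].
Qed.

(** The hypothesis prescribes the masses at j >= 1 only; they sum to 1 and leave nothing at 0. *)
Lemma visits_neq0 k : Q (V k @^-1` [set 0%N]) = 0%E.
Proof.
have [p0 p1] := andP pr_itv; have [_ hV _] := hNV.
have fq A : Q (V k @^-1` A) \is a fin_num by exact: fin_num_measure.
pose q j := fine (Q (V k @^-1` [set j])).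
have q0 : 0 <= q 0%N by rewrite /q fine_ge0.
have le1 M : \sum_(j < M) q j <= 1.
  have tr : trivIset setT (fun j : 'I_M => V k @^-1` [set (j : nat)]).
    apply/trivIsetP => i j _ _ ij; apply/seteqP; split=> w // -[/= -> e].
    by move: ij; rewrite -(inj_eq val_inj) /= e eqxx.
  have mA (j : 'I_M) : measurable (V k @^-1` [set (j : nat)]) by [].
  rewrite -lee_fin -sumEFin.
  rewrite (eq_bigr (fun j : 'I_M => Q (V k @^-1` [set (j : nat)]))); last first.
    by move=> j _; rewrite /q fineK.
  rewrite -(measure_bigsetU_ord Q xpredT mA tr); apply: probability_le1.
  exact: bigsetU_measurable.
have qS j : q j.+1 = pr * (1 - pr) ^+ j by rewrite /q hV.
have geo M : \sum_(j < M) pr * (1 - pr) ^+ j = 1 - (1 - pr) ^+ M.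
  elim: M => [|M IH]; first by rewrite big_ord0 expr0 subrr.
  by rewrite big_ord_recr/= IH exprS; ring.
have qle M : q 0%N <= (1 - pr) ^+ M.
  have := le1 M.+1; rewrite big_ord_recl/= (eq_bigr (fun j : 'I_M => pr * (1 - pr) ^+ j)).
    by rewrite geo; lra.
  by move=> j _; rewrite -qS.
have lim0 : ((1 - pr) ^+ M) @[M --> \oo] --> (0 : R).
  by apply: cvg_expr; rewrite ger0_norm; lra.
have q00 : q 0%N <= 0.
  rewrite -(cvg_lim _ lim0)//; apply: limr_ge; last by apply: nearW.
  by apply/cvg_ex; exists 0.
by rewrite -(fineK (fq _)) -/(q 0%N); congr EFin; apply/eqP; rewrite eq_le q00.
Qed.

Let Z : option nat -> {mfun T >-> nat} := oapp V N.

Definition cylinder (I : seq (option nat)) (A : option nat -> set nat) : set T :=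
  \big[setI/setT]_(i <- I) (Z i @^-1` A i).

Let measurable_cylinder I A : measurable (cylinder I A).
Proof. by apply: big_ind => //; exact: measurableI. Qed.

Definition visits_sum (k : nat) (w : T) : nat := \sum_(i < k) V i w.

Let measurable_visits_sum k j : measurable [set w | visits_sum k w = j].
Proof.
elim: k j => [|k IH] j.
  rewrite (_ : mkset _ = if j == 0%N then setT else set0); first by case: ifP.
  apply/seteqP; split=> w /=; rewrite /visits_sum big_ord0; first by move=> <-.
  by case: eqP => // ->.
rewrite (_ : mkset _ = \bigcup_(i in [set i | (i <= j)%N])
    (V k @^-1` [set i] `&` [set w | visits_sum k w = (j - i)%N])).
  by apply: bigcup_measurable => i _; exact: measurableI.
apply/seteqP; split=> w /=; rewrite /visits_sum big_ord_recr/=.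
  by move=> <-; exists (V k w); rewrite /= ?leq_addl ?addnK.
by move=> [i /= ij [-> ->]]; rewrite subnK.
Qed.

(* [geom_poly J] is the generating polynomial of [V k], truncated at degree J *)
Lemma cylinder_visits_sum J I A k j : uniq I ->
  (forall i, Some i \in I -> (k <= i)%N) -> (j < J)%N ->
  Q (cylinder I A `&` [set w | visits_sum k w = j]) =
  (fine (Q (cylinder I A)) * (geom_poly pr J ^+ k)`_j)%:E.
Proof.
have [_ hV ind] := hNV.
elim: k I A j => [|k IH] I A j uI kI jJ.
  rewrite expr0 coef1; case: j jJ => [|j] jJ.
    rewrite mulr1 fineK ?fin_num_measure//; congr (Q _).
    by apply/seteqP; split=> w; [case|move=> ?; split=> //=; rewrite /visits_sum big_ord0].
  rewrite mulr0 (_ : _ `&` _ = set0) ?measure0//.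
  by apply/seteqP; split=> w // -[_ /=]; rewrite /visits_sum big_ord0.
(* The condition on [V k] is absorbed into the cylinder; allowing arbitrary cylinders is what lets
   the induction use independence without treating the law of a sum jointly with the rest. *)
pose A' i o := if o == Some k then [set i] else A o.
have kNI : Some k \notin I by apply/negP => /kI; rewrite ltnn.
have cylS i : cylinder (Some k :: I) (A' i) = V k @^-1` [set i] `&` cylinder I A.
  rewrite /cylinder big_cons /A' eqxx; congr (_ `&` _).
  rewrite big_seq [RHS]big_seq; apply: eq_bigr => o oI; case: eqP => // ok.
  by move: kNI; rewrite -ok oI.
have Qcyl i : fine (Q (cylinder (Some k :: I) (A' i))) =
    fine (Q (V k @^-1` [set i])) * fine (Q (cylinder I A)).
  rewrite /cylinder !ind//=; last by rewrite kNI.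
  rewrite big_cons /A' eqxx; congr (_ * _).
  rewrite big_seq [RHS]big_seq; apply: eq_bigr => o oI; case: eqP => // ok.
  by move: kNI; rewrite -ok oI.
have Qg (i : 'I_j.+1) : fine (Q (V k @^-1` [set (i : nat)])) = (geom_poly pr J)`_i.
  have iJ : (i < J)%N by rewrite (leq_trans (ltn_ord i)).
  rewrite /geom_poly coef_poly iJ; case: (i : nat) => [|i']; first by rewrite visits_neq0.
  by rewrite hV.
pose F (i : 'I_j.+1) := cylinder (Some k :: I) (A' i) `&`
  [set w | visits_sum k w = (j - i)%N].
have -> : cylinder I A `&` [set w | visits_sum k.+1 w = j] =
    \big[setU/set0]_(i < j.+1) F i.
  rewrite -bigcup_mkord_ord; apply/seteqP; split=> w.
    move=> [cw /=]; rewrite /visits_sum big_ord_recr/= => sw.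
    have Vj : (V k w < j.+1)%N by rewrite ltnS -sw leq_addl.
    exists (V k w) => //=; rewrite /F/= inordK// cylS; split=> //=.
    by rewrite -sw addnK.
  move=> [i /= ij]; rewrite /F inordK// cylS => -[[/= Vi cw] sw]; split=> //=.
  rewrite /visits_sum big_ord_recr/= -/(visits_sum k w) sw Vi subnK//.
rewrite (measure_bigsetU_ord Q xpredT); last 2 first.
- by move=> i; exact: measurableI.
- apply/trivIsetP => i1 i2 _ _ i12; apply/seteqP; split=> w //.
  rewrite /F !cylS => -[[[/= e1 _] _] [[/= e2 _] _]].
  by move: i12; rewrite -(inj_eq val_inj) /= -e1 -e2 eqxx.
rewrite exprS coefM mulr_sumr -sumEFin; apply: eq_bigr => i _.
rewrite [LHS](IH (Some k :: I) (A' i) (j - i)%N).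
- by rewrite Qcyl Qg mulrA [X in X * _]mulrC.
- by rewrite /= kNI.
- move=> o; rewrite in_cons => /orP[/eqP[->] //|/kI]; exact: ltnW.
- by rewrite (leq_ltn_trans (leq_subr _ _)).
Qed.

(** Decomposition according to the value of [N]; only values below [J] matter, since almost surely
    each trajectory contributes at least one visit. *)
Lemma interlacement_pmf J j : 0 < alpha -> (j < J)%N ->
  fine (Q (interlacement_local_time R N V @^-1` [set j%:R])) =
  (compound_poly rate pr J)`_j.
Proof.
case: J => // J alpha0 jJ; have [hN _ _] := hNV.
have ltE w : (interlacement_local_time R N V w = j%:R) <-> visits_sum (N w) w = j.
  by rewrite /interlacement_local_time /visits_sum; split=> [/eqP|->//]; rewrite eqr_nat => /eqP.
have [p0 p1] := andP pr_itv.
have cylN m : cylinder [:: None] (fun=> [set m]) = N @^-1` [set m].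
  by rewrite /cylinder big_seq1.
have QN m : Q (N @^-1` [set m] `&` [set w | visits_sum m w = j]) =
    (poisson_pmf rate m * (geom_poly pr J.+1 ^+ m)`_j)%:E.
  by rewrite -cylN (@cylinder_visits_sum J.+1)// cylN hN.
set E := _ @^-1` _.
have EE : E = [set w | visits_sum (N w) w = j].
  by apply/seteqP; split=> w /ltE.
pose F (m : 'I_J.+1) := N @^-1` [set (m : nat)] `&` [set w | visits_sum m w = j].
have mF m : measurable (F m) by exact: measurableI.
have trF : trivIset setT F.
  apply/trivIsetP => i1 i2 _ _ i12; apply/seteqP; split=> w //.
  by move=> [[/= e1 _] [/= e2 _]]; move: i12; rewrite -(inj_eq val_inj) /= -e1 -e2 eqxx.
pose U := \big[setU/set0]_(m < J.+1) F m.
have mU : measurable U by exact: bigsetU_measurable.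
have mE : measurable E.
  by rewrite /E -[X in measurable X]setTI; apply: measurable_interlacement_local_time.
have UP w : U w <-> (N w < J.+1)%N /\ visits_sum (N w) w = j.
  rewrite /U -bigcup_mkord_ord; split.
    by move=> [m /= mJ]; rewrite /F inordK// => -[/= -> ->].
  by move=> [NJ vw]; exists (N w) => //; rewrite /F inordK.
have UE : E `&` U = U.
  by apply/seteqP; split=> w; [case|move=> Uw; split=> //; rewrite EE; case/UP: Uw].
(* If N is at least J + 1, the first J + 1 trajectories alone make at most j <= J visits in all: a
   null event, as [geom_poly] is divisible by X. *)
pose G (i : 'I_j.+1) := [set w | visits_sum J.+1 w = i].
have G0 : Q (\big[setU/set0]_(i < j.+1) G i) = 0%E.
  rewrite (measure_bigsetU_ord Q xpredT); last 2 first.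
  - by move=> i; exact: measurable_visits_sum.
  - apply/trivIsetP => i1 i2 _ _ i12; apply/seteqP; split=> w // -[/= e1 e2].
    by move: i12; rewrite -(inj_eq val_inj) /= -e1 -e2 eqxx.
  rewrite big1// => i _; transitivity (Q (G i)) => //; have := @cylinder_visits_sum J.+1 [::] (fun=> setT) J.+1 i.
  rewrite /cylinder big_nil setTI -/(G i) => -> //; last by rewrite (leq_trans (ltn_ord i)).
  have -> : geom_poly pr J.+1 = 'X * \poly_(l < J) (pr * (1 - pr) ^+ l).
    by apply/polyP => -[|l]; rewrite coefXM !coef_poly.
  by rewrite exprMn coefXnM (leq_trans (ltn_ord i))// mulr0.
have rest : Q (E `\` U) = 0%E.
  apply/eqP; rewrite eq_le measure_ge0 andbT -G0; apply: le_measure; rewrite ?inE.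
  - exact: measurableD.
  - by apply: bigsetU_measurable => i _; exact: measurable_visits_sum.
  move=> w [Ew NUw]; have JN : (J.+1 <= N w)%N.
    by rewrite leqNgt; apply/negP => NJ; apply: NUw; apply/UP; split=> //; move: Ew; rewrite EE.
  have sj : (visits_sum J.+1 w < j.+1)%N.
    move: Ew; rewrite EE /= ltnS => <-; rewrite -(subnKC JN) /visits_sum.
    by rewrite big_split_ord/= leq_addr.
  by rewrite -bigcup_mkord_ord; exists (visits_sum J.+1 w) => //; rewrite /G/= inordK.
have QE : Q E = (Q (E `\` U) + Q (E `&` U))%E by exact: measureDI.
have QU : Q U = (\sum_(m < J.+1) Q (F m))%E by exact: (measure_bigsetU_ord Q xpredT).
rewrite QE rest add0e UE QU.
rewrite (eq_bigr (fun m : 'I_J.+1 => (poisson_pmf rate m * (geom_poly pr J.+1 ^+ m)`_j)%:E)).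
  rewrite sumEFin /= /compound_poly coef_sum; apply: eq_bigr => m _.
  by rewrite coefZ.
by move=> m _; exact: QN.
Qed.

End InterlacementLaw.

(** * Conditioned local time *)

Section Assembly.
Variables (R : realType).

Lemma cond_probE (d : measure_display) (T : measurableType d) (P : probability T R)
    (E A : set T) (mE : measurable E) : P E != 0%E ->
  cond_prob P mE A = (P (A `&` E) * (fine (P E))^-1%:E)%E.
Proof.
move=> PE0; rewrite /cond_prob /= /mnormalize /= /mrestr setTI ifF//.
rewrite (negbTE PE0)/=; apply/negbTE.
by rewrite -ltey -ge0_fin_numE// fin_num_measure.
Qed.

Definition visit_pgf (alpha : R) (x n : nat) : {poly R} :=
  (iter (ring_time alpha n) (avg n) (inside R n) n)^-1
    *: visit_poly R n x (ring_time alpha n) n.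

Lemma visit_pgf_horner1 alpha x n : (1 < n)%N -> (visit_pgf alpha x n).[1] = 1.
Proof.
move=> n2; rewrite /visit_pgf hornerZ visit_poly_horner.
have -> : wavg n (site_weight x (1 : R)) = avg n.
  apply/funext => f; rewrite /wavg; congr avg; apply/funext => y.
  by rewrite /site_weight if_same mul1r.
rewrite mulVf// gt_eqF// (lt_le_trans _ (survival_ge R _ n2))//.
by rewrite exprn_gt0// cos_angle_gt0.
Qed.

Lemma visit_pgf_coef_ge0 alpha x n k : (1 < n)%N -> 0 <= (visit_pgf alpha x n)`_k.
Proof.
move=> n2; rewrite coefZ mulr_ge0 ?visit_poly_coef_ge0// invr_ge0.
by rewrite (le_trans _ (survival_ge R _ n2))// exprn_ge0// ltW// cos_angle_gt0.
Qed.

(* [kappa] is chosen so that the limiting tilt at [x] equals [z]. *)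
Lemma visit_pgf_cvg (alpha z : R) x : 0 < alpha -> (0 < x)%N -> 0 < z < 1 ->
  exists zs : nat -> R, zs n @[n --> \oo] --> z /\
    (visit_pgf alpha x n).[zs n] @[n --> \oo] -->
      compound_pgf (alpha * x%:R / 2) (2 * x%:R)^-1 z.
Proof.
move=> alpha0 x0 /andP[z0 z1].
have xR : 1 <= x%:R :> R by rewrite ler1n.
have x1 : 0 < x%:R :> R by rewrite ltr0n.
have d0 : 0 < z + 2 * x%:R * (1 - z) by rewrite addr_gt0// !mulr_gt0// subr_gt0.
pose kappa : R := 2 * x%:R ^+ 2 * (1 - z) / (z + 2 * x%:R * (1 - z)).
have k0 : 0 < kappa by rewrite divr_gt0// !mulr_gt0 ?exprn_gt0// subr_gt0.
have kx : kappa < x%:R.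
  rewrite ltr_pdivrMr// -subr_gt0.
  rewrite (_ : _ - _ = x%:R * z); first by rewrite mulr_gt0.
  by ring.
have kz : tilt_weight_lim kappa x = z.
  rewrite /tilt_weight_lim /kappa; field.
  rewrite (gt_eqF d0)/=.
  rewrite (_ : _ + _ = 2 * x%:R ^+ 2); last by ring.
  by rewrite gt_eqF// mulr_gt0// exprn_gt0.
(* For this kappa, 1 - [geom_pgf] at z equals kappa / x, and the Poisson rate alpha x / 2 turns it
   into alpha kappa / 2. *)
have pE : compound_pgf (alpha * x%:R / 2) (2 * x%:R)^-1 z = expR (- (alpha * kappa / 2)).
  rewrite /compound_pgf; congr (expR (- _)); rewrite /geom_pgf /kappa; field.
  by rewrite (gt_eqF d0) (gt_eqF x1).
exists (fun n => tilt_weight n x kappa); rewrite -{1}kz pE; split.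
  exact: tilt_weight_cvg.
under eq_cvg do rewrite /visit_pgf hornerZ visit_poly_horner mulrC.
exact: survival_ratio_cvg.
Qed.

End Assembly.

Theorem theorem1p3 (R : realType) (alpha : R) (x : nat)
    (alpha_gt0 : 0 < alpha) (x_gt0 : (0 < x)%N)
    (d0 : measure_display) (T0 : measurableType d0) (Q : probability T0 R)
    (N : {mfun T0 >-> nat}) (V : nat -> {mfun T0 >-> nat})
    (hNV : interlacement_visits alpha x Q N V)
    (d : nat -> measure_display) (T : forall n, measurableType (d n))
    (P : forall n, probability (T n) R)
    (X : forall n, nat -> {mfun T n >-> nat})
    (hX : forall n, (x < n)%N -> is_ring_walk (P n) n n (X n)) :
  cvg_in_law
    (fun n => cond_prob (P n)
       (measurable_avoids_origin (X n) (ring_time alpha n)))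
    (fun n => local_time R (X n) (ring_time alpha n) x)
    Q (interlacement_local_time R N V).
Proof.
apply: pmf_cvg_in_law => [w|k]; first by exists (\sum_(k < N w) V k w)%N.
have xR : 1 <= x%:R :> R by rewrite ler1n.
have coefs : (visit_pgf alpha x n)`_k @[n --> \oo] -->
    fine (Q (interlacement_local_time R N V @^-1` [set k%:R])).
  apply: (coef_cvg (q := fun k =>
    fine (Q (interlacement_local_time R N V @^-1` [set k%:R])))
    (Phi := compound_pgf (alpha * x%:R / 2) (2 * x%:R)^-1)).
  - near=> n; have n2 : (1 < n)%N by near: n; exact: nbhs_infty_gt.
    by split=> [j|]; [exact: visit_pgf_coef_ge0|rewrite visit_pgf_horner1].
  - by move=> z; exact: visit_pgf_cvg.
  - have rate0 : 0 < alpha * x%:R / 2 by rewrite divr_gt0// mulr_gt0// ltr0n.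
    have pr0 : 0 < (2 * x%:R)^-1 :> R by rewrite invr_gt0 mulr_gt0// ltr0n.
    have pr1 : (2 * x%:R)^-1 < 1 :> R by rewrite invf_lt1; lra.
    move=> J; have [C HC] := compound_poly_approx rate0 pr0 pr1 J.
    exists C => z hz; rewrite (eq_bigr (fun j : 'I_J.+1 =>
      (compound_poly (alpha * x%:R / 2) (2 * x%:R)^-1 J.+1)`_j * z ^+ j)); first exact: HC.
    by move=> j _; rewrite (interlacement_pmf x_gt0 hNV (J := J.+1)).
apply: cvg_trans coefs; apply: near_eq_cvg; near=> n.
have xn : (x < n)%N by near: n; exact: nbhs_infty_gt.
have n2 : (1 < n)%N by rewrite (leq_trans _ xn).
have PE := avoiding_prob n2 (hX n xn) (ring_time alpha n).
(* Positive survival probability excludes the conventional value of [cond_prob]. *)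
have U0 : 0 < iter (ring_time alpha n) (avg n) (inside R n) n.
  by rewrite (lt_le_trans _ (survival_ge R _ n2))// exprn_gt0// cos_angle_gt0.
rewrite cond_probE ?PE; last by rewrite eqe gt_eqF.
rewrite setIC (visits_avoiding n2 (hX n xn))//; last by rewrite ltn_eqF.
by rewrite -EFinM /= /visit_pgf coefZ mulrC.
Unshelve. all: by end_near. Qed.
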